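(* Let $p\in\mathcal{R}(\mathbb{T},\mathbb{H})$. If $p$ is real-valued, or if $p(t)=\alpha$ for all $t$ with $\alpha\in\mathbb{H}\setminus\mathbb{R}$ a quaternion constant, then $\psi_p(t,s)=E_p(t,s)$ for all $s,t\in\mathbb{T}$.
   Context: A time scale $\mathbb{T}$ is a nonempty closed subset of $\mathbb{R}$. For $t\in\mathbb{T}$: $\sigma(t)=\inf\{s\in\mathbb{T}:s>t\}$, $\rho(t)=\sup\{s\in\mathbb{T}:s<t\}$ (with $\inf\emptyset=\sup\mathbb{T}$, $\sup\emptyset=\inf\mathbb{T}$), $\mu(t)=\sigma(t)-t$. The point $t$ is right-dense if $\sigma(t)=t$ and left-dense if $\rho(t)=t$. $\mathbb{T}^\kappa=\mathbb{T}\setminus(\rho(\sup\mathbb{T}),\sup\mathbb{T}]$ if $\sup\mathbb{T}<\infty$, and $\mathbb{T}^\kappa=\mathbb{T}$ otherwise. $\mathbb{H}$ is the skew field of quaternions with units $i,j,k$. A function $f:\mathbb{T}\to\mathbb{H}$ has delta derivative $f^\Delta(t)$ at $t\in\mathbb{T}^\kappa$ if for every $\varepsilon>0$ there is $\delta>0$ with $|f(\sigma(t))-f(s)-f^\Delta(t)(\sigma(t)-s)|\le\varepsilon|\sigma(t)-s|$ for all $s\in(t-\delta,t+\delta)\cap\mathbb{T}$. $f$ is rd-continuous if each of its four real components is continuous at right-dense points and has finite left-sided limits at left-dense points. For rd-continuous $f$, $\int_r^s f(t)\Delta t=F(s)-F(r)$, where $F^\Delta=f$ on $\mathbb{T}^\kappa$.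 $\mathcal{R}(\mathbb{T},\mathbb{H})$ is the set of rd-continuous $p:\mathbb{T}\to\mathbb{H}$ that are regressive, i.e. $1+\mu(t)p(t)\ne0$ for all $t\in\mathbb{T}^\kappa$. For a quaternion $q=q_0+q_1i+q_2j+q_3k$ write $\Re(q)=q_0$, $\Im(q)=q_1i+q_2j+q_3k$, and $\exp(q)=\sum_{n\ge0}q^n/n!$. The principal logarithm of $q\neq 0$ is $\mathrm{Ln}(q)=\ln|q|+\frac{\Im(q)}{|\Im(q)|}\arccos\frac{\Re(q)}{|q|}$ if $q\in\mathbb{H}\setminus\mathbb{R}$, and $\mathrm{Ln}(q)=\ln|q|+i\pi\frac{1-\mathrm{sgn}(q)}{2}$ if $q\in\mathbb{R}$. The cylinder transformation is $\xi_h(q)=\frac1h\mathrm{Ln}(1+qh)$ for $h>0$ and $\xi_0(q)=q$. The generalized quaternion exponential is $E_p(t,s)=\exp\left(\int_s^t\xi_{\mu(\tau)}(p(\tau))\Delta\tau\right)$. For $p\in\mathcal{R}(\mathbb{T},\mathbb{H})$ and $s\in\mathbb{T}$, $\psi_p(\cdot,s)$ denotes the unique solution on $\mathbb{T}$ of the initial value problem $y^\Delta(t)=p(t)y(t)$ ($t\in\mathbb{T}^\kappa$), $y(s)=1$. *)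

(* Defs.v *)
From HB Require Import structures.
From mathcomp Require Import all_boot all_order all_algebra.
From mathcomp Require Import all_classical all_reals all_analysis.
From mathcomp Require Import ring lra.

Set Implicit Arguments.
Unset Strict Implicit.
Unset Printing Implicit Defensive.
Import Order.TTheory GRing.Theory Num.Theory.
Import numFieldNormedType.Exports.
Local Open Scope classical_set_scope.
Local Open Scope ring_scope.

Record quat (R : Type) := Quat { q0 : R; q1 : R; q2 : R; q3 : R }.

Lemma quat_eq (R : Type) (x y : quat R) :
  q0 x = q0 y -> q1 x = q1 y -> q2 x = q2 y -> q3 x = q3 y -> x = y.
Proof. by case: x => a b c d; case: y => a' b' c' d' /= -> -> -> ->. Qed.

Section QuatAlgebra.
Variable R : realType.
Local Notation H := (quat R).

Let to_prod (x : H) := (q0 x, q1 x, q2 x, q3 x).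
Let of_prod (u : R * R * R * R) : H := Quat u.1.1.1 u.1.1.2 u.1.2 u.2.
Let to_prodK : cancel to_prod of_prod. Proof. by case. Qed.

HB.instance Definition _ := Choice.copy H (can_type to_prodK).

Definition quat_add (x y : H) : H :=
  Quat (q0 x + q0 y) (q1 x + q1 y) (q2 x + q2 y) (q3 x + q3 y).
Definition quat_opp (x : H) : H := Quat (- q0 x) (- q1 x) (- q2 x) (- q3 x).
Definition quat_scale (a : R) (x : H) : H :=
  Quat (a * q0 x) (a * q1 x) (a * q2 x) (a * q3 x).
Definition quat_mul (x y : H) : H :=
  Quat (q0 x * q0 y - q1 x * q1 y - q2 x * q2 y - q3 x * q3 y)
       (q0 x * q1 y + q1 x * q0 y + q2 x * q3 y - q3 x * q2 y)
       (q0 x * q2 y - q1 x * q3 y + q2 x * q0 y + q3 x * q1 y)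
       (q0 x * q3 y + q1 x * q2 y - q2 x * q1 y + q3 x * q0 y).
Definition quat_norm (x : H) : R :=
  Num.sqrt (q0 x ^+ 2 + q1 x ^+ 2 + q2 x ^+ 2 + q3 x ^+ 2).

Let addqA : associative quat_add.
Proof. by move=> x y z; apply: quat_eq => /=; ring. Qed.
Let addqC : commutative quat_add.
Proof. by move=> x y; apply: quat_eq => /=; ring. Qed.
Let add0q : left_id (Quat 0 0 0 0) quat_add.
Proof. by move=> x; apply: quat_eq => /=; ring. Qed.
Let addNq : left_inverse (Quat 0 0 0 0) quat_opp quat_add.
Proof. by move=> x; apply: quat_eq => /=; ring. Qed.

HB.instance Definition _ := GRing.isZmodule.Build H addqA addqC add0q addNq.

Let mulqA : associative quat_mul.
Proof. by move=> x y z; apply: quat_eq => /=; ring. Qed.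
Let mul1q : left_id (Quat 1 0 0 0) quat_mul.
Proof. by move=> x; apply: quat_eq => /=; ring. Qed.
Let mulq1 : right_id (Quat 1 0 0 0) quat_mul.
Proof. by move=> x; apply: quat_eq => /=; ring. Qed.
Let mulqDl : left_distributive quat_mul +%R.
Proof. by move=> x y z; apply: quat_eq => /=; ring. Qed.
Let mulqDr : right_distributive quat_mul +%R.
Proof. by move=> x y z; apply: quat_eq => /=; ring. Qed.
Let oneq_neq0 : Quat 1 0 0 0 != 0 :> H.
Proof. by apply/eqP => -[] /eqP; rewrite oner_eq0. Qed.

HB.instance Definition _ := GRing.Zmodule_isNzRing.Build H
  mulqA mul1q mulq1 mulqDl mulqDr oneq_neq0.

Let scaleqA a b (x : H) : quat_scale a (quat_scale b x) = quat_scale (a * b) x.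
Proof. by apply: quat_eq => /=; ring. Qed.
Let scale1q : left_id 1 quat_scale.
Proof. by move=> x; apply: quat_eq => /=; ring. Qed.
Let scaleqDr : right_distributive quat_scale +%R.
Proof. by move=> a x y; apply: quat_eq => /=; ring. Qed.
Let scaleqDl (x : H) : {morph quat_scale^~ x : a b / a + b}.
Proof. by move=> a b; apply: quat_eq => /=; ring. Qed.

HB.instance Definition _ := GRing.Zmodule_isLmodule.Build R H
  scaleqA scale1q scaleqDr scaleqDl.

Let scaleqAl a (x y : H) : a *: (x * y) = a *: x * y.
Proof. by apply: quat_eq => /=; ring. Qed.

HB.instance Definition _ := GRing.Lmodule_isLalgebra.Build R H scaleqAl.

Let normqD (x y : H) : quat_norm (x + y) <= quat_norm x + quat_norm y.
Proof.
case: x y => [a b c d] [e f g h]; rewrite /quat_norm /=.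
set X := a ^+ 2 + _ + _ + _; set Y := e ^+ 2 + _ + _ + _.
have X0 : 0 <= X by rewrite !addr_ge0 ?sqr_ge0.
have Y0 : 0 <= Y by rewrite !addr_ge0 ?sqr_ge0.
have CS : a * e + b * f + c * g + d * h <= Num.sqrt X * Num.sqrt Y.
  rewrite -sqrtrM //; apply: le_trans (ler_norm _) _.
  rewrite -sqrtr_sqr ler_wsqrtr // -subr_ge0.
  have -> : X * Y - (a * e + b * f + c * g + d * h) ^+ 2 =
      (a * f - b * e) ^+ 2 + (a * g - c * e) ^+ 2 + (a * h - d * e) ^+ 2
      + (b * g - c * f) ^+ 2 + (b * h - d * f) ^+ 2 + (c * h - d * g) ^+ 2.
    by rewrite /X /Y; ring.
  by rewrite !addr_ge0 ?sqr_ge0.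
have S0 : 0 <= Num.sqrt X + Num.sqrt Y by rewrite addr_ge0 ?sqrtr_ge0.
rewrite -[leRHS]ger0_norm // -sqrtr_sqr ler_wsqrtr //.
rewrite [leRHS]sqrrD !sqr_sqrtr // -subr_ge0.
have -> : X + Num.sqrt X * Num.sqrt Y *+ 2 + Y -
    ((a + e) ^+ 2 + (b + f) ^+ 2 + (c + g) ^+ 2 + (d + h) ^+ 2) =
    (Num.sqrt X * Num.sqrt Y - (a * e + b * f + c * g + d * h)) *+ 2.
  by rewrite /X /Y; ring.
by rewrite mulrn_wge0 // subr_ge0.
Qed.

Let normqZ a (x : H) : quat_norm (a *: x) = `|a| * quat_norm x.
Proof.
rewrite /quat_norm /= -sqrtr_sqr -sqrtrM ?sqr_ge0 //.
by congr (Num.sqrt _); ring.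
Qed.

Let normq0_eq0 (x : H) : quat_norm x = 0 -> x = 0.
Proof.
case: x => a b c d; rewrite /quat_norm /= => /eqP.
rewrite sqrtr_eq0 => le0.
have [a0 b0 c0 d0] : [/\ 0 <= a ^+ 2, 0 <= b ^+ 2, 0 <= c ^+ 2 & 0 <= d ^+ 2].
  by rewrite !sqr_ge0.
have z (u : R) : 0 <= u ^+ 2 -> u ^+ 2 <= 0 -> u = 0.
  by move=> h1 h2; apply/eqP; rewrite -sqrf_eq0 eq_le h1 h2.
by apply: quat_eq => /=; apply: z => //; lra.
Qed.

HB.instance Definition _ := Lmodule_isNormed.Build R H normqD normqZ normq0_eq0.

End QuatAlgebra.

Section QuatFunctions.
Variable R : realType.
Local Notation H := (quat R).

Definition qi : H := Quat 0 1 0 0.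
Definition reQ (q : H) : R := q0 q.
Definition imQ (q : H) : H := Quat 0 (q1 q) (q2 q) (q3 q).
Definition is_realQ (q : H) : bool := imQ q == 0.

Definition expQ (q : H) : H :=
  limn (series (fun n => (n`!%:R : R)^-1 *: q ^+ n)).

Definition LnQ (q : H) : H :=
  if is_realQ q then (ln `|q|)%:A + (pi * ((1 - Num.sg (reQ q)) / 2)) *: qi
  else (ln `|q|)%:A + acos (reQ q / `|q|) *: (`|imQ q|^-1 *: imQ q).

Definition cylinder (h : R) (q : H) : H :=
  if h == 0 then q else h^-1 *: LnQ (1 + h *: q).

End QuatFunctions.

(* A time scale is a subset T of R; functions on T are functions on R whose
   values outside T are irrelevant. *)
Section TimeScale.
Variables (R : realType) (T : set R).
Local Notation H := (quat R).

Definition time_scale := T !=set0 /\ closed T.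

(* sup and inf return 0 on the empty set, hence the explicit conventions
   inf set0 = sup T and sup set0 = inf T. For t in T, the else branches are
   reached only when T has a maximum (resp. minimum). *)
Definition sigma (t : R) : R :=
  if pselect ([set s | T s /\ t < s] !=set0)
  then inf [set s | T s /\ t < s] else sup T.

Definition rho (t : R) : R :=
  if pselect ([set s | T s /\ s < t] !=set0)
  then sup [set s | T s /\ s < t] else inf T.

Definition mu (t : R) : R := sigma t - t.

Definition right_dense (t : R) := sigma t = t.
Definition left_dense (t : R) := rho t = t.

Definition Tkappa : set R :=
  if pselect (has_ubound T) then T `\` `]rho (sup T), sup T]%classic else T.

Definition is_delta_derive (f : R -> H) (t : R) (d : H) :=
  forall eps : R, 0 < eps -> exists2 delta : R, 0 < delta &
    forall s, T s -> t - delta < s < t + delta ->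
      `|f (sigma t) - f s - (sigma t - s) *: d| <= eps * `|sigma t - s|.

Definition rd_continuousR (f : R -> R) :=
  (forall t, T t -> right_dense t -> f x @[x --> within T (nbhs t)] --> f t) /\
  (forall t, T t -> left_dense t -> cvg (f x @[x --> within T t^'-])).

Definition rd_continuous (f : R -> H) :=
  [/\ rd_continuousR (fun t => q0 (f t)), rd_continuousR (fun t => q1 (f t)),
      rd_continuousR (fun t => q2 (f t)) & rd_continuousR (fun t => q3 (f t))].

Definition regressive (p : R -> H) :=
  forall t, Tkappa t -> 1 + mu t *: p t != 0.

Definition rd_regressive (p : R -> H) := rd_continuous p /\ regressive p.

Definition delta_antiderivative (f F : R -> H) :=
  forall t, Tkappa t -> is_delta_derive F t (f t).

(* The value is independent of the chosen antiderivative, since two of them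
   differ by a constant on T. *)
Definition delta_integral (f : R -> H) (r s : R) : H :=
  let F := xget (fun=> 0) [set F | delta_antiderivative f F] in F s - F r.

Definition gen_exp (p : R -> H) (t s : R) : H :=
  expQ (delta_integral (fun tau => cylinder (mu tau) (p tau)) s t).

Definition solves_ivp (p : R -> H) (s : R) (y : R -> H) :=
  (forall t, Tkappa t -> is_delta_derive y t (p t * y t)) /\ y s = 1.

(* Uniqueness can only be asked for on T. The default value 0 is never a
   value of gen_exp, so psi p t s = gen_exp p t s can only hold when the
   initial value problem does have a unique solution. *)
Definition psi (p : R -> H) (t s : R) : H :=
  xget (fun=> 0) [set y | solves_ivp p s y /\
    forall z, solves_ivp p s z -> {in T, z =1 y}] t.

End TimeScale.

(* Main.v *)
(* In both cases p takes its values in a commutative plane R + R u, u a unit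
   imaginary quaternion (u = i, or u = Im alpha / |Im alpha|), on which
   exp (a + b u) = e^a (cos b + u sin b), and cylinder (mu t) (p t) stays in that
   plane with rd-continuous coordinates c0, c1. With F0, F1 antiderivatives of
   c0, c1 vanishing at s, the function Y = exp (F0 + F1 u) solves the initial
   value problem. If z is another solution, then exp (- F0 - F1 u) z has zero
   delta derivative, hence is constant on T, so z = Y. *)
Require Import Defs.
From mathcomp Require Import all_boot all_order all_algebra.
From mathcomp Require Import all_classical all_reals all_analysis.
From mathcomp Require Import ring lra.

Set Implicit Arguments.
Unset Strict Implicit.
Unset Printing Implicit Defensive.
Import Order.TTheory GRing.Theory Num.Theory.
Import numFieldNormedType.Exports.

Local Open Scope classical_set_scope.
Local Open Scope ring_scope.

(** * Delta differentiation *)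

Section TimeScaleBasics.
Variables (R : realType) (T : set R).
Implicit Types (s t : R).

(** Both sides of the claim are picked by [xget]. For [psi] to avoid its default, the solution has
    to exist and be unique on T; for [delta_integral], some antiderivative of the cylinder transform
    has to exist, and the chosen one must agree on T, up to a constant, with the explicit one. The
    delicate point is the rd-continuity of [cylinder (mu t) (p t)], since Ln jumps across the
    negative reals and the graininess is not continuous. Where |p| is bounded by K, however, 1 + mu
    p can reach the cut only if mu is at least 1/K, and close to any t only t itself can have large
    graininess. So near t, but away from t, the coordinates c0, c1 are uniformly close to those of
    p. They inherit local boundedness and continuity at right-dense points, and antiderivatives are
    built from these two properties. A competing solution z takes values in all of H and need not
    commute with the plane of p. The inverse exponential therefore multiplies z from the left, on
    the same side as p in the equation. *)

Lemma near_withinP t (P : R -> Prop) :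
  (\forall s \near within T (nbhs t), P s) <->
  (exists2 delta, 0 < delta &
    forall s, T s -> t - delta < s < t + delta -> P s).
Proof.
split.
  move=> /nbhs_ballP[d /= d0 Hd]; exists d => // s Ts ts.
  by apply: Hd => //; rewrite /ball /= ltr_norml; lra.
move=> [d d0 Hd]; apply/nbhs_ballP; exists d => //= s.
by rewrite /ball /= ltr_norml => ts Ts; apply: Hd => //; lra.
Qed.

Lemma sigma_le s t : T s -> t < s -> sigma T t <= s.
Proof.
move=> Ts ts; rewrite /sigma; case: pselect => [ne|[]]; last by exists s.
by apply: ge_inf => //; exists t; move=> x [] _ /ltW.
Qed.

Lemma sigma_max t : T t -> ~ (exists2 s, T s & t < s) -> sigma T t = t.
Proof.
move=> Tt N; rewrite /sigma; case: pselect => [[s [Ts ts]]|nN].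
  by exfalso; apply: N; exists s.
have ub : ubound T t.
  by move=> x Tx; rewrite leNgt; apply/negP => tx; apply: N; exists x.
apply/eqP; rewrite eq_le ge_sup ?ub_le_sup //=; first by exists t.
by exists t.
Qed.

Lemma sigma_ge t : T t -> t <= sigma T t.
Proof.
move=> Tt; have [[s Ts ts]|N] := pselect (exists2 s, T s & t < s); last first.
  by rewrite sigma_max.
rewrite /sigma; case: pselect => [ne|[]]; last by exists s.
by apply: lb_le_inf => // x [] _ /ltW.
Qed.

Lemma mu_ge0 t : T t -> 0 <= mu T t.
Proof. by move=> /sigma_ge; rewrite /mu subr_ge0. Qed.

Lemma sigma_lt s t : T s -> s < sigma T t -> s <= t.
Proof.
by move=> Ts; apply: contraTT; rewrite -leNgt -ltNge => /sigma_le; apply.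
Qed.

Lemma sigma_approx t e : T t -> 0 < e -> (exists2 s, T s & t < s) ->
  exists2 s, T s & t < s < sigma T t + e.
Proof.
move=> Tt e0 [s Ts ts]; rewrite /sigma; case: pselect => [ne|[]]; last by exists s.
have [|x [Tx tx] xe] := @inf_adherent R [set s | T s /\ t < s] e e0.
  by split => //; exists t; move=> x [] _ /ltW.
by exists x => //; rewrite tx.
Qed.

Lemma sigma_mem t : closed T -> T t -> T (sigma T t).
Proof.
move=> cT Tt; have [ex|N] := pselect (exists2 s, T s & t < s); last first.
  by rewrite sigma_max.
apply: cT => B /nbhs_ballP[e /= e0 Be].
have [s Ts /andP[ts se]] := sigma_approx Tt e0 ex.
exists s; split => //; apply: Be; rewrite /ball /= ltr_norml.
by have := sigma_le Ts ts; lra.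
Qed.

Lemma Tkappa_sub t : Tkappa T t -> T t.
Proof. by rewrite /Tkappa; case: pselect => // _ []. Qed.

Lemma rho_ge s t : T s -> s < t -> s <= rho T t.
Proof.
move=> Ts st; rewrite /rho; case: pselect => [ne|[]]; last by exists s.
by apply: ub_le_sup => //; exists t; move=> x [] _ /ltW.
Qed.

Lemma rho_le t : T t -> rho T t <= t.
Proof.
move=> Tt; rewrite /rho; case: pselect => [ne|N].
  by apply: ge_sup => // x [] _ /ltW.
apply: ge_inf => //; exists t; move=> x Tx.
by rewrite leNgt; apply/negP => xt; apply: N; exists x.
Qed.

Lemma Tkappa_lt s t : T t -> T s -> t < s -> Tkappa T t.
Proof.
move=> Tt Ts ts; rewrite /Tkappa; case: pselect => // ub; split => // /=.
rewrite in_itv /= => /andP[+ _]; apply/negP; rewrite -leNgt rho_ge //.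
exact: lt_le_trans ts (ub_le_sup _ _).
Qed.

(** The interval removed to form $\mathbb{T}^\kappa$ starts at rho (sup T), and no point of T lies
    strictly between rho (sup T) and sup T. A point approached from the left by T therefore
    survives, even when it is the maximum. *)
Lemma Tkappa_left t : T t ->
  (forall e, 0 < e -> exists2 s, T s & t - e < s < t) -> Tkappa T t.
Proof.
move=> Tt L; rewrite /Tkappa; case: pselect => // ub; split => // /=.
rewrite in_itv /= => /andP[rt tS].
have [|s Ts] := L (t - rho T (sup T)); first by rewrite subr_gt0.
rewrite subKr => /andP[rs st].
by have := rho_ge Ts (lt_le_trans st tS); rewrite leNgt rs.
Qed.

(** A gap starting at s < t ends at t at the latest. If t is right-dense and not maximal, a point r
    of T with t < r < t + e stops every gap starting in (t, r). If t is right-scattered or maximal,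
    no s > t is close. The point t itself has to be exempted, as its graininess may be large. *)
Lemma near_mu_small t e : T t -> 0 < e ->
  \forall s \near within T (nbhs t), s = t \/ mu T s < e.
Proof.
move=> Tt e0; apply/near_withinP.
have [[s Ts ts]|N] := pselect (exists2 s, T s & t < s); last first.
  exists e => // x Tx /andP[xl xr].
  have [xt|tx|->] := ltgtP x t; [right| |by left].
    by have := sigma_le Tt xt; rewrite /mu; lra.
  by exfalso; apply: N; exists x.
have /predU1P[/esym st|ts'] : (t == sigma T t) || (t < sigma T t).
- by rewrite -le_eqVlt sigma_ge.
- have [|r Tr /andP[tr re]] := @sigma_approx t e Tt e0; first by exists s.
  exists (Num.min e (r - t)); first by rewrite lt_min e0 subr_gt0.
  move=> x Tx /andP[xl]; rewrite -ltrBlDl lt_min => /andP[xr xr'].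
  move: xl; rewrite ltrBlDr -ltrBlDl lt_min => /andP[xl xl'].
  have [xt|tx|->] := ltgtP x t; [right|right|by left].
    by have := sigma_le Tt xt; rewrite /mu; lra.
  have : x < r by lra.
  by move/(sigma_le Tr); rewrite /mu; lra.
- exists (Num.min e (sigma T t - t)); first by rewrite lt_min e0 subr_gt0.
  move=> x Tx /andP[xl]; rewrite -ltrBlDl lt_min => /andP[xr xr'].
  move: xl; rewrite ltrBlDr -ltrBlDl lt_min => /andP[xl xl'].
  have [xt|tx|->] := ltgtP x t; [right| |by left].
    by have := sigma_le Tt xt; rewrite /mu; lra.
  by have := sigma_le Tx tx; lra.
Qed.

End TimeScaleBasics.

Section DeltaDifferentiation.
Variables (R : realType) (V : normedModType R) (T : set R).
Implicit Types (f g : R -> V) (s t : R).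

(* For V = quat R this is convertible to is_delta_derive. *)
Definition delta_diff f t (d : V) :=
  forall eps : R, 0 < eps -> exists2 delta : R, 0 < delta &
    forall s, T s -> t - delta < s < t + delta ->
      `|f (sigma T t) - f s - (sigma T t - s) *: d| <= eps * `|sigma T t - s|.

Lemma delta_diffP f t d : delta_diff f t d <->
  forall eps : R, 0 < eps -> \forall s \near within T (nbhs t),
      `|f (sigma T t) - f s - (sigma T t - s) *: d| <= eps * `|sigma T t - s|.
Proof. by split=> H eps /H ?; apply/near_withinP. Qed.

(** The point s = t is admissible in the definition for every eps, so the error at it must
    vanish. *)
Lemma delta_diff_sigma f t d : T t -> delta_diff f t d ->
  f (sigma T t) - f t = mu T t *: d.
Proof.
move=> Tt D; apply/eqP; rewrite -subr_eq0 -normr_le0; apply/ler_addgt0Pl => e e0.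
have m0 := mu_ge0 Tt; rewrite addr0.
have [|dl dl0 H] := D (e / (mu T t + 1)); first by rewrite divr_gt0 //; lra.
have /H : t - dl < t < t + dl by lra.
move=> /(_ Tt) /le_trans; apply; rewrite -/(mu T t) ger0_norm //.
by rewrite mulrAC ler_pdivrMr ?ler_pM2l; lra.
Qed.

Lemma delta_diff_cvg f t d : T t -> delta_diff f t d ->
  f s @[s --> within T (nbhs t)] --> f t.
Proof.
move=> Tt D; apply/cvgrPdist_le => e e0.
have m0 := mu_ge0 Tt.
have d0 := normr_ge0 d.
(* After f (sigma t) is replaced by f t + mu d, the error is at most k |sigma t - s| + |t - s| |d|.
   With |t - s| at most min 1 k this is at most k (mu + 1 + |d|). *)
have k0 : 0 < e / (mu T t + 1 + `|d| + 1) by rewrite divr_gt0 //; lra.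
have [dl dl0 H] := D (e / (mu T t + 1 + `|d| + 1)) k0; apply/near_withinP.
exists (Num.min dl (Num.min 1 (e / (mu T t + 1 + `|d| + 1)))).
  by rewrite !lt_min dl0 ltr01.
set k := e / _ in k0 H *.
have ek : e = k * (mu T t + 1 + `|d| + 1) by rewrite /k mulfVK //; lra.
move=> s Ts /andP[+]; rewrite -ltrBlDl !lt_min => + /and3P[sr sr' sr''].
rewrite ltrBlDr -ltrBlDl !lt_min => /and3P[sl sl' sl''].
have Hs : `|f (sigma T t) - f s - (sigma T t - s) *: d|
  <= k * `|sigma T t - s| by apply: H => //; lra.
have -> : f t - f s = (f (sigma T t) - f s - (sigma T t - s) *: d) + (t - s) *: d.
  have /eqP := delta_diff_sigma Tt D; rewrite subr_eq => /eqP ->.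
  have -> : (t - s) *: d = (sigma T t - s) *: d - mu T t *: d.
    by rewrite -scalerBl; congr (_ *: _); rewrite /mu; ring.
  by rewrite addrA subrK addrAC (addrC (mu T t *: d)) addrK.
apply: le_trans (ler_normD _ _) _; rewrite normrZ.
have h1 : `|t - s| <= k by rewrite ler_norml; lra.
have h2 : `|sigma T t - s| <= mu T t + 1.
  have -> : sigma T t - s = mu T t + (t - s) by rewrite /mu; ring.
  by rewrite ler_norml; lra.
rewrite ek; apply: (@le_trans _ _ (k * (mu T t + 1) + k * `|d|)); last by nra.
apply: lerD; last by rewrite ler_wpM2r.
by apply: le_trans Hs _; rewrite ler_wpM2l // ltW.
Qed.

(** Near a right-scattered t the factor |sigma t - s| stays above mu / 2, so the allowed error is at
    least e mu / 2, while the actual error tends to 0 by continuity; each of its two terms is kept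
    below e mu / 4. *)
Lemma delta_diff_scattered f t d : T t -> t < sigma T t ->
  f s @[s --> within T (nbhs t)] --> f t ->
  f (sigma T t) - f t = mu T t *: d -> delta_diff f t d.
Proof.
move=> Tt m0 cf E; apply/delta_diffP => e e0.
have k0 : 0 < e * mu T t / 4 by rewrite !mulr_gt0 // subr_gt0.
have /cvgrPdist_le/(_ _ k0) H1 := cf.
have d0 := normr_ge0 d.
have H2 : \forall s \near within T (nbhs t), `|t - s| <= mu T t / 2 /\
    `|t - s| * `|d| <= e * mu T t / 4.
  apply/near_withinP.
  exists (Num.min (mu T t / 2) (e * mu T t / 4 / (`|d| + 1))).
    rewrite lt_min divr_gt0 ?subr_gt0 //= divr_gt0 //; lra.
  move=> s Ts /andP[+]; rewrite -ltrBlDl !lt_min => + /andP[sr sr'].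
  rewrite ltrBlDr -ltrBlDl !lt_min => /andP[sl sl'].
  have h : `|t - s| <= mu T t / 2 by rewrite ler_norml; lra.
  split => //.
  have : `|t - s| <= e * mu T t / 4 / (`|d| + 1) by rewrite ler_norml; lra.
  rewrite ler_pdivlMr; last lra.
  by apply: le_trans; rewrite ler_wpM2l //; lra.
near=> s.
have -> : f (sigma T t) - f s - (sigma T t - s) *: d = (f t - f s) - (t - s) *: d.
  move/eqP : E; rewrite subr_eq => /eqP ->.
  have -> : (sigma T t - s) *: d = mu T t *: d + (t - s) *: d.
    by rewrite -scalerDl; congr (_ *: _); rewrite /mu; ring.
  by rewrite opprD addrA; congr (_ - _); rewrite addrAC (addrC (mu T t *: d)) addrK.
apply: le_trans (ler_normB _ _) _; rewrite normrZ.
have [h1 h2] : `|t - s| <= mu T t / 2 /\ `|t - s| * `|d| <= e * mu T t / 4.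
  by near: s.
have h3 : `|f t - f s| <= e * mu T t / 4 by near: s.
have h4 : mu T t / 2 <= `|sigma T t - s|.
  apply: le_trans (ler_norm _); move: h1; rewrite ler_norml /mu; lra.
by apply: le_trans (_ : e * (mu T t / 2) <= _); [lra|rewrite ler_pM2l].
Unshelve. all: by end_near. Qed.

Lemma delta_diff_dense f t d : T t -> sigma T t = t ->
  (forall e, 0 < e -> \forall s \near within T (nbhs t),
     `|f t - f s - (t - s) *: d| <= e * `|t - s|) -> delta_diff f t d.
Proof. by move=> Tt st H; apply/delta_diffP; rewrite st. Qed.

Lemma delta_diffB f g t d d' : delta_diff f t d -> delta_diff g t d' ->
  delta_diff (fun s => f s - g s) t (d - d').
Proof.
move=> /delta_diffP F /delta_diffP G; apply/delta_diffP => e e0.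
have e2 : 0 < e / 2 by lra.
have Fe := F _ e2; have Ge := G _ e2; near=> s.
have hF : `|f (sigma T t) - f s - (sigma T t - s) *: d| <= e / 2 * `|sigma T t - s|.
  by near: s.
have hG : `|g (sigma T t) - g s - (sigma T t - s) *: d'| <= e / 2 * `|sigma T t - s|.
  by near: s.
rewrite (splitr e) mulrDl; apply: le_trans (lerD hF hG).
apply: le_trans (ler_normB _ _); rewrite le_eqVlt; apply/orP; left; apply/eqP.
congr `|_|.
by rewrite /= scalerBr !opprB !addrA [LHS](ACl (1*4*6*5*3*2))%AC.
Unshelve. all: by end_near. Qed.

(* Supremum argument: the largest c in T `&` [a, b] satisfying the
   Lipschitz bound with constant e can only be b. *)
Lemma delta_diff0_le f a b e : closed T ->
  (forall t, Tkappa T t -> delta_diff f t 0) -> T a -> T b -> a <= b -> 0 < e ->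
  `|f b - f a| <= e * (b - a).
Proof.
move=> cT D Ta Tb ab e0.
pose S := [set x | [/\ T x, a <= x <= b & `|f x - f a| <= e * (x - a)]].
have Sa : S a by split; rewrite ?lexx ?ab // !subrr normr0 mulr0.
have ubS : ubound S b by move=> x [_ /andP[]].
have hS : has_sup S by split; [exists a|exists b].
pose c := sup S.
have cb : c <= b by apply: ge_sup => //; exists a.
have ac : a <= c by apply: ub_le_sup => //; exists b.
(* If c were outside S, points of S would accumulate at c from the left. Then c is in T by
   closedness and in $\mathbb{T}^\kappa$ by left-density, and continuity carries the bound over to
   c. *)
have Sc : S c.
  have [//|nSc] := pselect (S c).
  have L e' : 0 < e' -> exists2 s, S s & c - e' < s < c.
    move=> /sup_adherent/(_ hS)[s Ss cs]; exists s => //; rewrite cs /=.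
    rewrite lt_neqAle ub_le_sup ?andbT //; last by exists b.
    by apply/eqP => sc; apply: nSc; rewrite -sc.
  have Tc : T c.
    apply: cT => B /nbhs_ballP[e' /= e'0 Be].
    have [s [Ts _ _] sc] := L _ e'0; exists s; split => //; apply: Be.
    by rewrite /ball /= ltr_norml; lra.
  have kc : Tkappa T c.
    by apply: Tkappa_left => // e' /L[s [Ts _ _] ?]; exists s.
  split; rewrite ?ac //.
  apply/ler_addgt0Pl => e' e'0.
  have /cvgrPdist_le/(_ _ e'0)/near_withinP[d d0 Hd] := delta_diff_cvg Tc (D c kc).
  have [s [Ts sab se] sc] := L _ d0.
  rewrite -(subrKA (f s)); apply: le_trans (ler_normD _ _) _; apply: lerD.
    by apply: Hd => //; lra.
  by apply: le_trans se _; rewrite ler_wpM2l ?ltW //; lra.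
have [Tc _ ce] := Sc.
move: cb; rewrite le_eqVlt => /predU1P[<- //|cb].
have kc := Tkappa_lt Tc Tb cb.
(* When c < b the bound propagates beyond c: to a nearby point of T if c is right-dense, and to
   sigma c otherwise, where f keeps its value. *)
suff [s [Ts sab se] cs] : exists2 s, S s & c < s.
  by have := ub_le_sup (ex_intro _ b ubS) (And3 Ts sab se); rewrite leNgt cs.
have /predU1P[sc|cs] : (c == sigma T c) || (c < sigma T c).
- by rewrite -le_eqVlt sigma_ge.
- have [d d0 H] := D c kc e e0; rewrite -sc in H.
  have [||s Ts] := @sigma_approx R T c (Num.min d (b - c)) Tc.
  + by rewrite lt_min d0 subr_gt0.
  + by exists b.
  rewrite -sc -ltrBlDl lt_min => /andP[cs /andP[sd sb]].
  exists s => //; split => //; first lra.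
  rewrite -(subrKA (f c)).
  apply: le_trans (ler_normD _ _) _.
  have : `|f c - f s - (c - s) *: 0| <= e * `|c - s| by apply: H => //; lra.
  rewrite scaler0 subr0 distrC (distrC c) [X in _ <= _ * X]ger0_norm; last lra.
  lra.
- exists (sigma T c) => //; split; first exact: sigma_mem.
  + by have := sigma_le Tb cb; lra.
  + have /eqP := delta_diff_sigma Tc (D c kc).
    rewrite scaler0 subr_eq0 => /eqP ->; apply: le_trans ce _.
    by rewrite ler_wpM2l ?ltW //; lra.
Qed.

Lemma delta_diff0_cst f a b : closed T ->
  (forall t, Tkappa T t -> delta_diff f t 0) -> T a -> T b -> f a = f b.
Proof.
move=> cT D.
wlog ab : a b / a <= b => [H Ta Tb|Ta Tb].
  by have [/H|/ltW/H] := leP a b; [|move=> /(_ Tb Ta)->]; first exact.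
apply/esym/eqP; rewrite -subr_eq0 -normr_le0; apply/ler_addgt0Pl => e e0.
have k0 : 0 < e / (b - a + 1) by rewrite divr_gt0 //; lra.
apply: le_trans (delta_diff0_le cT D Ta Tb ab k0) _.
by rewrite addr0 mulrAC ler_pdivrMr ?ler_pM2l; lra.
Qed.

End DeltaDifferentiation.

(** * Antiderivatives *)

Section Antiderivative.
Variables (R : realType) (T : set R).
Hypothesis clT : closed T.
Implicit Types (f : R -> R) (s t a b : R).

(** A consequence of rd-continuity that suffices for the lower integral and that, unlike one-sided
    limits, passes easily to the coordinates of the cylinder transform. *)
Definition locally_bounded f := forall t, T t ->
  exists K, \forall s \near within T (nbhs t), `|f s| <= K.

Lemma locally_bounded_segment f a b : locally_bounded f ->
  exists K, forall s, T s -> a <= s <= b -> `|f s| <= K.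
Proof.
move=> lf.
have /compact_near_coveringP/(_ R +oo (fun K x => T x -> `|f x| <= K)) :=
  @segment_compact R a b.
move=> /(_ _) []; last first.
  move=> K [_ HK]; exists (K + 1) => s Ts sab.
  by apply: (HK (K + 1) _ s) => //=; rewrite ?in_itv //; rewrite ltrDl.
(* Since T is closed, a point outside T has a whole neighbourhood with nothing to bound. *)
move=> x _; have [Tx|nTx] := pselect (T x); last first.
  have /open_nbhs_nbhs : open_nbhs x (~` T) by split => //; exact: closed_openC.
  move=> nx; exists (~` T, setT) => /=; first by split => //; exact: filterT.
  by move=> [y i] [].
have [K HK] := lf x Tx.
exists ([set s | T s -> `|f s| <= K], [set i | K <= i]) => /=.
  by split; [exact: HK|apply: nbhs_pinfty_ge; exact: num_real].
by move=> [y i] [/= Hy Ki] /Hy/le_trans; apply.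
Qed.

(* Perron-style lower integral: bounds and additivity hold for every bounded
   f, so no integrability theory is needed. *)
Definition sub_primitive f a b (G : R -> R) := forall x y M,
  T x -> T y -> a <= x -> x <= y -> y <= b ->
  (forall s, T s -> x <= s < y -> f s <= M) -> G y - G x <= M * (y - x).

Definition lower_integral f a b :=
  sup [set G b - G a | G in sub_primitive f a b].

(** Any M bounding f on [x, y) satisfies m <= f x <= M, because x itself lies in that interval when
    x < y. For x = y the interval is empty and both sides vanish. *)
Lemma sub_primitive_linear f a b m :
  (forall s, T s -> a <= s < b -> m <= f s) ->
  sub_primitive f a b (fun x => m * x).
Proof.
move=> mf x y M Tx Ty ax; rewrite le_eqVlt => /predU1P[->|xy] yb H.
  by rewrite !subrr mulr0.
have : m <= M by apply: le_trans (mf x Tx _) (H x Tx _); lra.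
by rewrite -mulrBr; apply: ler_wpM2r; lra.
Qed.

Lemma lower_integral_has_sup f a b m M : T a -> T b -> a <= b ->
  (forall s, T s -> a <= s < b -> m <= f s <= M) ->
  has_sup [set G b - G a | G in sub_primitive f a b].
Proof.
move=> Ta Tb ab H; split.
  exists (m * b - m * a), (fun x => m * x) => //.
  by apply: sub_primitive_linear => s Ts /(H s Ts)/andP[].
exists (M * (b - a)) => _ [G HG <-]; apply: HG => // s Ts.
by move=> /(H s Ts)/andP[].
Qed.

(** The right endpoint is excluded so that the estimate is sharp across a gap: on [a, sigma a) the
    only point of T is a, so m = M = f a is allowed. *)
Lemma lower_integral_bounds f a b m M : T a -> T b -> a <= b ->
  (forall s, T s -> a <= s < b -> m <= f s <= M) ->
  m * (b - a) <= lower_integral f a b <= M * (b - a).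
Proof.
move=> Ta Tb ab H; have [ne ub] := lower_integral_has_sup Ta Tb ab H.
apply/andP; split.
  rewrite mulrBr; apply: ub_le_sup => //; exists (fun x => m * x) => //.
  by apply: sub_primitive_linear => s Ts /(H s Ts)/andP[].
apply: ge_sup => // _ [G HG <-]; apply: HG => // s Ts.
by move=> /(H s Ts)/andP[].
Qed.

(** A competitor on [a, c] restricts to both halves, which gives one inequality. Conversely,
    competitors on the halves are glued at b, and an interval straddling b is split there, which is
    legitimate because b is in T. *)
Lemma lower_integralD f a b c : locally_bounded f ->
  T a -> T b -> T c -> a <= b -> b <= c ->
  lower_integral f a c = lower_integral f a b + lower_integral f b c.
Proof.
move=> /(@locally_bounded_segment _ a c)[K HK] Ta Tb Tc ab bc.
have Hf s : T s -> a <= s -> s <= c -> - K <= f s <= K.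
  by move=> Ts ? ?; rewrite -ler_norml; apply: HK => //; apply/andP.
have [ne ub] : has_sup [set G c - G a | G in sub_primitive f a c].
  by apply: (@lower_integral_has_sup _ _ _ (- K) K) => // [|s Ts ?]; [lra|apply: Hf => //; lra].
have hs1 : has_sup [set G b - G a | G in sub_primitive f a b].
  by apply: (@lower_integral_has_sup _ _ _ (- K) K) => // s Ts ?; apply: Hf => //; lra.
have hs2 : has_sup [set G c - G b | G in sub_primitive f b c].
  by apply: (@lower_integral_has_sup _ _ _ (- K) K) => // s Ts ?; apply: Hf => //; lra.
apply/eqP; rewrite eq_le; apply/andP; split.
  apply: ge_sup => // _ [G HG <-].
  rewrite -(subrKA (G b)) addrC; apply: lerD; apply: ub_le_sup.
  - by case: hs1.
  - by exists G => // x y M Tx Ty ? ? ? H; apply: HG => //; lra.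
  - by case: hs2.
  - by exists G => // x y M Tx Ty ? ? ? H; apply: HG => //; lra.
rewrite /lower_integral -sup_sumE //; apply: ge_sup.
  have [[u Hu] _] := hs1; have [[v Hv] _] := hs2.
  by exists (u + v), u => //; exists v.
move=> _ [_ [G HG <-] [_ [G' HG' <-] <-]]; apply: ub_le_sup => //.
exists (fun x => if x <= b then G x else G b + (G' x - G' b)); last first.
  rewrite ab; case: ifP => cb; last by ring.
  have -> : c = b by apply/eqP; rewrite eq_le cb.
  by ring.
move=> x y M Tx Ty ax xy yc H.
have [yb|yb] := leP y b.
  by rewrite (le_trans xy yb); apply: HG.
have [xb|xb] := leP x b.
  have h1 : G b - G x <= M * (b - x).
    by apply: HG => // s Ts ?; apply: H => //; lra.
  have h2 : G' y - G' b <= M * (y - b).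
    by apply: HG' => //; [exact: ltW|move=> s Ts ?; apply: H => //; lra].
  by lra.
have h : G' y - G' x <= M * (y - x) by apply: HG' => //; exact: ltW.
by lra.
Qed.

(** The lower integral from a base point t0, with its sign reversed below t0. The two-sided bound is
    all that the construction of the antiderivative uses about F. *)
Lemma lower_primitive f : T !=set0 -> locally_bounded f ->
  exists F, forall a b m M, T a -> T b -> a <= b ->
    (forall s, T s -> a <= s < b -> m <= f s <= M) ->
    m * (b - a) <= F b - F a <= M * (b - a).
Proof.
move=> [t0 Tt0] lf.
exists (fun t => if t0 <= t then lower_integral f t0 t
                 else - lower_integral f t t0) => a b m M Ta Tb ab H.
rewrite [X in _ <= X <= _](_ : _ = lower_integral f a b).
  exact: lower_integral_bounds.
have [ta|ta] := leP t0 a.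
  by rewrite (le_trans ta ab) (lower_integralD lf Tt0 Ta Tb) // addrAC subrr add0r.
rewrite opprK; have [tb|tb] := leP t0 b.
  by rewrite addrC -lower_integralD // ltW.
by rewrite (lower_integralD lf Ta Tb Tt0) ?(ltW tb) // addrC addrK.
Qed.

(** At a right-dense t the values of f near t lie within e of f t, and the bounds on F squeeze the
    difference quotient. At a right-scattered t they give the jump mu f t exactly, and local
    boundedness gives the continuity of F. A maximum of T satisfies sigma t = t and falls under the
    dense case. *)
Lemma antiderivative_exists f : T !=set0 -> locally_bounded f ->
  (forall t, T t -> right_dense T t -> f s @[s --> within T (nbhs t)] --> f t) ->
  exists F : R -> R, forall t, T t -> delta_diff T F t (f t).
Proof.
move=> T0 lf cf; have [F HF] := lower_primitive T0 lf.
exists F => t Tt.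
have /predU1P[st|ts] : (t == sigma T t) || (t < sigma T t).
- by rewrite -le_eqVlt sigma_ge.
- apply: delta_diff_dense => // e e0.
  have /cvgrPdist_le/(_ _ e0)/near_withinP[d d0 Hd] := cf t Tt (esym st).
  apply/near_withinP; exists d => // s Ts sd.
  change (`|F t - F s - (t - s) * f t| <= e * `|t - s| :> R).
  have Hf x : T x -> t - d < x < t + d -> f t - e <= f x <= f t + e.
    by move=> Tx /(Hd x Tx); rewrite ler_norml; lra.
  have [ts|st'] := leP t s.
    have := HF t s (f t - e) (f t + e) Tt Ts ts.
    rewrite (ler0_norm (_ : t - s <= 0)) ?subr_le0 // ler_norml => H.
    have /H : forall x, T x -> t <= x < s -> f t - e <= f x <= f t + e.
      by move=> x Tx ?; apply: Hf => //; lra.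
    by nra.
  have := HF s t (f t - e) (f t + e) Ts Tt (ltW st').
  have ts0 : 0 <= t - s by rewrite subr_ge0 ltW.
  rewrite (ger0_norm ts0) ler_norml => H.
  have /H : forall x, T x -> s <= x < t -> f t - e <= f x <= f t + e.
    by move=> x Tx ?; apply: Hf => //; lra.
  by nra.
- apply: delta_diff_scattered => //; last first.
    have := HF t (sigma T t) (f t) (f t) Tt (sigma_mem clT Tt) (ltW ts).
    move=> /(_ _)/le_anti <-; first by rewrite mulrC.
    move=> s Ts /andP[ls /(sigma_lt Ts) sl].
    have -> : s = t by apply/eqP; rewrite eq_le sl.
    by rewrite lexx.
  have [K /near_withinP[d d0 Hd]] := lf t Tt.
  apply/cvgrPdist_le => e e0; apply/near_withinP.
  have K0 : 0 <= K by apply: le_trans (Hd t Tt _) => //; lra.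
  exists (Num.min d (e / (K + 1))).
    by rewrite lt_min d0 divr_gt0 //; lra.
  move=> s Ts /andP[+]; rewrite -ltrBlDl !lt_min => + /andP[sr sr'].
  rewrite ltrBlDr -ltrBlDl !lt_min => /andP[sl sl'].
  move: sl' sr'; rewrite !ltr_pdivlMr; [|lra|lra] => sl' sr'.
  have [le|lt] := leP t s.
    have := HF t s (- K) K Tt Ts le; rewrite ler_norml => H.
    have /H : forall x, T x -> t <= x < s -> - K <= f x <= K.
      by move=> x Tx ?; rewrite -ler_norml; apply: Hd => //; lra.
    by nra.
  have := HF s t (- K) K Ts Tt (ltW lt); rewrite ler_norml => H.
  have /H : forall x, T x -> s <= x < t -> - K <= f x <= K.
    by move=> x Tx ?; rewrite -ler_norml; apply: Hd => //; lra.
  by nra.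
Qed.

End Antiderivative.

(** * The quaternion exponential *)

Section CauchyProduct.

Lemma sum_triangle (V : nmodType) (F : nat -> nat -> V) N :
  \sum_(n < N) \sum_(i < n.+1) F i (n - i)%N =
  \sum_(i < N) \sum_(0 <= j < N - i) F i j.
Proof.
elim: N => [|N IH]; first by rewrite !big_ord0.
rewrite big_ord_recr /= IH [RHS]big_ord_recr /= subSnn big_nat1.
under [in RHS]eq_bigr => i _ do rewrite subSn ?(ltnW (ltn_ord i)) // big_nat_recr //=.
by rewrite big_split /= -addrA; congr (_ + _); rewrite big_ord_recr /= subnn.
Qed.

(** The square i, j < N minus the triangle i + j < N is the corner i + j >= N. Writing it as a sum
    of products lets its norm be compared term by term with a real corner. *)
Lemma cauchy_product_diff (A : pzRingType) (a b : nat -> A) N :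
  (\sum_(i < N) a i) * (\sum_(j < N) b j) -
    \sum_(n < N) \sum_(i < n.+1) a i * b (n - i)%N =
  \sum_(i < N) \sum_(N - i <= j < N) a i * b j.
Proof.
rewrite (sum_triangle (fun i j => a i * b j)) mulr_suml -sumrB.
apply: eq_bigr => i _; rewrite mulr_sumr.
rewrite -(big_mkord xpredT (fun j => a i * b j)).
by rewrite (big_cat_nat (leq0n (N - i)) (leq_subr i N)) /= addrAC subrr add0r.
Qed.

End CauchyProduct.

Section QuaternionExponential.
Variable R : realType.
Local Notation H := (quat R).

Lemma quat_normE (x : H) :
  `|x| = Num.sqrt (q0 x ^+ 2 + q1 x ^+ 2 + q2 x ^+ 2 + q3 x ^+ 2).
Proof. by []. Qed.

(** Euler's four-square identity under the square root. *)
Lemma quat_normM (x y : H) : `|x * y| = `|x| * `|y|.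
Proof.
rewrite !quat_normE -sqrtrM; last by rewrite !addr_ge0 ?sqr_ge0.
by congr Num.sqrt; rewrite /=; ring.
Qed.

Lemma quat_norm1 : `|1 : H| = 1.
Proof. by rewrite quat_normE /= !expr0n !addr0 expr1n sqrtr1. Qed.

Lemma quat_normX (x : H) n : `|x ^+ n| = `|x| ^+ n.
Proof.
by elim: n => [|n IH]; rewrite ?expr0 ?quat_norm1 // !exprS quat_normM IH.
Qed.

Lemma quat_scalerAr (a : R) (x y : H) : a *: (x * y) = x * (a *: y).
Proof. by apply: quat_eq => /=; ring. Qed.

Lemma quat_scalerA (a b : R) (x : H) : a *: (b *: x) = (a * b) *: x.
Proof. exact: scalerA. Qed.

Definition expQ_coeff (x : H) : H ^nat := fun n => (n`!%:R : R)^-1 *: x ^+ n.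

Lemma expQ_coeff_norm x n : `|expQ_coeff x n| = exp_coeff `|x| n.
Proof.
by rewrite normrZ quat_normX ger0_norm ?invr_ge0 ?ler0n // mulrC.
Qed.

Lemma expQ_coeffD (x y : H) n : GRing.comm x y ->
  expQ_coeff (x + y) n = \sum_(i < n.+1) expQ_coeff x i * expQ_coeff y (n - i)%N.
Proof.
move=> cxy; rewrite /expQ_coeff addrC exprDn_comm; last exact: commr_sym.
rewrite scaler_sumr; apply: eq_bigr => -[i /= ilt] _.
rewrite -scalerAl -quat_scalerAr quat_scalerA -(commrX _ (commr_sym (commrX _ _))) //.
rewrite -[(_ * _) *+ _](@scaler_nat R) quat_scalerA; congr (_ *: _).
have /(congr1 (fun n => n%:R : R)) := bin_fact (ilt : (i <= n)%N).
rewrite !natrM => <-.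
have f0 k : (k`!)%:R != 0 :> R by rewrite pnatr_eq0 -lt0n fact_gt0.
rewrite !invfM; field.
by rewrite !f0 /= pnatr_eq0 -lt0n bin_gt0.
Qed.

(* The missing corner of the Cauchy product is dominated by the
   corresponding real corner, which vanishes because expR is additive. *)
Lemma series_expQD_diff (x y : H) : GRing.comm x y ->
  series (expQ_coeff x) n * series (expQ_coeff y) n -
    series (expQ_coeff (x + y)) n @[n --> \oo] --> (0 : H).
Proof.
move=> cxy.
have Z : series (exp_coeff `|x|) n * series (exp_coeff `|y|) n -
    series (exp_coeff (`|x| + `|y|)) n @[n --> \oo] --> (0 : R).
  rewrite -(subrr (expR (`|x| + `|y|))) {1}expRD.
  by apply: cvgB; [apply: cvgM|]; exact: is_cvg_series_exp_coeff.
apply/norm_cvg0P; apply: (@squeeze_cvgr _ _ _ _ (fun=> 0)) Z; last exact: cvg_cst.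
near=> n; rewrite normr_ge0 /= /series /= !big_mkord.
under [X in _ - X]eq_bigr => i _ do rewrite expQ_coeffD //.
rewrite cauchy_product_diff.
under [X in _ <= _ - X]eq_bigr => i _.
  rewrite (_ : exp_coeff _ _ = \sum_(j < i.+1) exp_coeff `|x| j * exp_coeff `|y| (i - j)%N); last first.
    rewrite /exp_coeff /= addrC exprDn mulr_suml; apply: eq_bigr => -[j /= jlt] _.
    have /(congr1 (fun n => n%:R : R)) := bin_fact (jlt : (j <= i)%N).
    rewrite !natrM => <-.
    have f0 k : (k`!)%:R != 0 :> R by rewrite pnatr_eq0 -lt0n fact_gt0.
    rewrite -mulr_natr; field.
    by rewrite !f0 /= pnatr_eq0 -lt0n bin_gt0.
  over.
rewrite cauchy_product_diff.
apply: le_trans (ler_norm_sum _ _ _) _; apply: ler_sum => i _.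
apply: le_trans (ler_norm_sum _ _ _) _; apply: ler_sum => j _.
by rewrite quat_normM !expQ_coeff_norm.
Unshelve. all: by end_near. Qed.

(** * The exponential on the plane R + R u *)

Definition cisQ (u : H) (a b : R) : H := expR a *: ((cos b)%:A + sin b *: u).

Lemma expQ_coeff_real (a : R) n : expQ_coeff a%:A n = (exp_coeff a n)%:A.
Proof.
rewrite /expQ_coeff /exp_coeff /= mulrC -quat_scalerA; congr (_ *: _).
elim: n => [|n IH]; first by rewrite !expr0 scale1r.
by rewrite !exprS IH -scalerAl mul1r quat_scalerA.
Qed.

(** Even powers of u are real signs and odd powers are signs times u, and the cosine and sine
    coefficients vanish at the complementary parity. *)
Lemma expQ_coeff_imag (u : H) (b : R) n : u * u = -1 ->
  expQ_coeff (b *: u) n = (cos_coeff b n)%:A + sin_coeff b n *: u.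
Proof.
move=> uu; have u2 k : u ^+ k.*2 = ((-1) ^+ k)%:A.
  rewrite -mul2n exprM expr2 uu; elim: k => [|k IH]; first by rewrite !expr0 scale1r.
  by rewrite !exprS IH mulN1r mulN1r scaleNr.
have E k : (b *: u) ^+ k = b ^+ k *: u ^+ k.
  elim: k => [|k IH]; first by rewrite !expr0 scale1r.
  by rewrite !exprS IH -scalerAl -quat_scalerAr quat_scalerA.
rewrite /expQ_coeff E /cos_coeff /sin_coeff /=.
rewrite -[in u ^+ n](odd_double_half n); case: (boolP (odd n)) => on /=.
  rewrite exprS u2 /= !mul0r scale0r add0r mul1r.
  rewrite -quat_scalerAr mulr1 !quat_scalerA; congr (_ *: _).
  have -> : n.-1./2 = n./2 by rewrite -{1}(odd_double_half n) on /= doubleK.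
  by ring.
rewrite add0n u2 !mul0r scale0r addr0 mul1r !quat_scalerA; congr (_ *: _).
by rewrite -exprnP; ring.
Qed.

(** The real and imaginary parts commute, so the series of their sum has the same limit as the
    product of their series, and that product is made of the real series of exp, cos and sin. *)
Lemma series_expQ_cvg (u : H) (a b : R) : u * u = -1 ->
  series (expQ_coeff (a%:A + b *: u)) n @[n --> \oo] --> cisQ u a b.
Proof.
move=> uu.
have cab : GRing.comm (a%:A : H) (b *: u).
  by rewrite /GRing.comm -scalerAl mul1r -quat_scalerAr mulr1.
have E n : series (expQ_coeff a%:A) n * series (expQ_coeff (b *: u)) n =
    series (exp_coeff a) n *: ((series (cos_coeff b) n)%:A + series (sin_coeff b) n *: u).
  rewrite /series /=.
  under eq_bigr do rewrite expQ_coeff_real.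
  under [X in _ * X = _]eq_bigr do rewrite expQ_coeff_imag //.
  by rewrite -scaler_suml -scalerAl mul1r big_split /= -!scaler_suml.
have L : series (expQ_coeff a%:A) n * series (expQ_coeff (b *: u)) n
    @[n --> \oo] --> cisQ u a b.
  under eq_fun do rewrite E.
  apply: cvgZ; first exact: is_cvg_series_exp_coeff.
  apply: cvgD; apply: cvgZr_tmp; rewrite ?unlock.
    exact: is_cvg_series_cos_coeff.
  exact: is_cvg_series_sin_coeff.
rewrite -[cisQ u a b]subr0.
rewrite (_ : (fun n => series (expQ_coeff (a%:A + b *: u)) n) =
  (fun n => series (expQ_coeff a%:A) n * series (expQ_coeff (b *: u)) n -
    (series (expQ_coeff a%:A) n * series (expQ_coeff (b *: u)) n -
     series (expQ_coeff (a%:A + b *: u)) n))); last first.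
  by apply/funext => n; rewrite subKr.
exact: cvgB L (series_expQD_diff cab).
Qed.

Lemma expQE (u : H) (a b : R) : u * u = -1 -> expQ (a%:A + b *: u) = cisQ u a b.
Proof. by move=> uu; apply/cvg_lim; [exact: norm_hausdorff|exact: series_expQ_cvg]. Qed.

Lemma cisQD (u : H) (a b a' b' : R) : u * u = -1 ->
  cisQ u (a + a') (b + b') = cisQ u a b * cisQ u a' b'.
Proof.
move=> uu; rewrite /cisQ expRD cosD sinD -scalerAl -quat_scalerAr quat_scalerA.
congr (_ *: _); rewrite mulrDl !mulrDr -!scalerAl -!quat_scalerAr uu !mul1r mulr1.
by rewrite !quat_scalerA scalerN scalerBl scalerDl (AC (2*2) ((1*4)*(3*2)))%AC.
Qed.

Lemma cisQ00 (u : H) : cisQ u 0 0 = 1.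
Proof. by rewrite /cisQ expR0 cos0 sin0 scale0r addr0 !scale1r. Qed.

Lemma cisQN (u : H) (a b : R) : u * u = -1 -> cisQ u (- a) (- b) * cisQ u a b = 1.
Proof. by move=> uu; rewrite -cisQD // !addNr cisQ00. Qed.

End QuaternionExponential.

(** * Chain and product rules *)

Lemma exists_small_factor (R : realFieldType) (M e : R) : 0 < M -> 0 < e ->
  exists k : R, [/\ 0 < k, k <= 1 & k * M <= e].
Proof.
move=> M0 e0; exists (Num.min 1 (e / M)); rewrite lt_min ltr01 divr_gt0 //.
by split=> //; rewrite ?ge_min ?lexx // -ler_pdivlMr // ge_min lexx orbT.
Qed.

Lemma is_derive1_littleo (R : realType) (g : R -> R) (x l e : R) :
  is_derive x 1 g l -> 0 < e ->
  exists2 d : R, 0 < d &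
    forall h : R, `|h| <= d -> `|g (x + h) - g x - l * h| <= e * `|h|.
Proof.
move=> [dg vg] e0.
have /cvgrPdist_le/(_ _ e0) :
    h^-1 *: ((g \o shift x) (h *: 1) - g x) @[h --> (0 : R)^'] --> l.
  by rewrite -vg; exact: dg.
(* Halving d turns the open ball into the closed condition |h| <= d. The value h = 0, missing from
   the punctured filter, is treated apart. *)
move=> /nbhs_ballP[d /= d0 Hd]; exists (d / 2); first by rewrite divr_gt0.
move=> h hd.
have [->|h0] := eqVneq h 0.
  by rewrite addr0 subrr mulr0 subrr normr0 mulr0.
have bh : ball (0 : R) d h by rewrite /ball /= sub0r normrN; lra.
have := Hd h bh h0; rewrite /= /GRing.scale /= mulr1 (addrC h x).
have -> : g (x + h) - g x - l * h = - (l - h^-1 * (g (x + h) - g x)) * h.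
  by field.
by rewrite normrM normrN => H; apply: ler_wpM2r.
Qed.

Section QuaternionDelta.
Variables (R : realType) (T : set R).
Local Notation H := (quat R).
Implicit Types (s t : R).

Lemma cisQ_littleo (u : H) (e : R) : `|u| = 1 -> 0 < e -> exists2 d : R, 0 < d &
  forall a b : R, `|a| <= d -> `|b| <= d ->
    `|cisQ u a b - 1 - (a%:A + b *: u)| <= e * (`|a| + `|b|).
Proof.
(* The error is at most k |a| + 2 k |b| in the real coordinate and 5 k |b| along u, in total at most
   7 k (|a| + |b|). *)
move=> u1 e0; have [k [k0 k1 ke]] := exists_small_factor (ltr0n R 7) e0.
have [dE dE0 HE] := is_derive1_littleo (is_derive_expR 0) k0.
have [dS dS0 HS] := is_derive1_littleo (is_derive_sin 0) k0.
have [dC dC0 HC] := is_derive1_littleo (is_derive_cos 0) k0.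
exists (Num.min (Num.min dE k) (Num.min dS dC)).
  by rewrite !lt_min dE0 dS0 dC0 k0.
move=> a b; rewrite !le_min => /andP[/andP[ad ak] _] /andP[_ /andP[bS bC]].
have := HE a ad; have := HS b bS; have := HC b bC.
rewrite !add0r expR0 sin0 cos0 oppr0 mul0r !subr0 !addr0 !mul1r.
set E := expR a; set S := sin b; set C := cos b => hC hS hE.
have -> : cisQ u a b - 1 - (a%:A + b *: u) =
    (E * C - 1 - a)%:A + (E * S - b) *: u.
  rewrite /cisQ -/E -/S -/C !scalerBl !scalerDr !quat_scalerA scale1r opprD.
  by rewrite !addrA (AC 5 (1*3*4*2*5))%AC.
apply: le_trans (ler_normD _ _) _; rewrite !normrZ u1 quat_norm1 !mulr1.
have C1 : `|C| <= 1 by rewrite ler_norml cos_geN1 cos_le1.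
have a1 : `|a| <= 1 by lra.
have a0 := normr_ge0 a. have b0 := normr_ge0 b.
have h1 : `|E * C - 1 - a| <= k * `|a| + 2 * (k * `|b|).
  have -> : E * C - 1 - a = (E - 1 - a) * C + (1 + a) * (C - 1) by ring.
  apply: le_trans (ler_normD _ _) _; rewrite !normrM; apply: lerD.
    by rewrite -[leRHS]mulr1; apply: ler_pM.
  apply: ler_pM => //.
  by apply: le_trans (ler_normD _ _) _; rewrite normr1; lra.
have h2 : `|E * S - b| <= 5 * (k * `|b|).
  have -> : E * S - b = (E - 1) * S + (S - b) by ring.
  have hE1 : `|E - 1| <= 2 * k.
    rewrite -(subrK a (E - 1)); apply: le_trans (ler_normD _ _) _.
    have : k * `|a| <= `|a| by apply: ler_piMl.
    by lra.
  have hS1 : `|S| <= 2 * `|b|.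
    rewrite -(subrK b S); apply: le_trans (ler_normD _ _) _.
    have : k * `|b| <= `|b| by apply: ler_piMl.
    by lra.
  apply: le_trans (ler_normD _ _) _; rewrite normrM.
  have : `|E - 1| * `|S| <= (2 * k) * (2 * `|b|) by apply: ler_pM.
  by nra.
by nra.
Qed.

Lemma cisQ_cvg (u : H) (F : set_system R) (a b : R -> R) (la lb : R) :
  Filter F -> a s @[s --> F] --> la -> b s @[s --> F] --> lb ->
  cisQ u (a s) (b s) @[s --> F] --> cisQ u la lb.
Proof.
move=> FF ca cb; apply: cvgZ.
  exact: (continuous_cvg _ (@continuous_expR R la) ca).
apply: cvgD; apply: cvgZr_tmp.
  exact: (continuous_cvg _ (@continuous_cos R lb) cb).
exact: (continuous_cvg _ (@continuous_sin R lb) cb).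
Qed.

(** Chain rule on a time scale: D is the linear coefficient at a right-dense point, but across a gap
    it must satisfy exp (mu c) = 1 + mu D, the relation that the cylinder transform inverts. D is
    left abstract so that the rule serves both the solution and its inverse. *)
Lemma delta_diff_cisQ (u : H) (F0 F1 : R -> R) (c0 c1 : R) (D : H) t :
  u * u = -1 -> `|u| = 1 -> T t ->
  delta_diff T F0 t c0 -> delta_diff T F1 t c1 ->
  (mu T t = 0 -> D = c0%:A + c1 *: u) ->
  cisQ u (mu T t * c0) (mu T t * c1) = 1 + mu T t *: D ->
  delta_diff T (fun s => cisQ u (F0 s) (F1 s)) t (D * cisQ u (F0 t) (F1 t)).
Proof.
move=> uu u1 Tt dF0 dF1 D0 DE.
have : (t == sigma T t) || (t < sigma T t) by rewrite -le_eqVlt sigma_ge.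
move=> /predU1P[st|ts]; last first.
  apply: delta_diff_scattered => //.
    by apply: cisQ_cvg; [exact: delta_diff_cvg dF0|exact: delta_diff_cvg dF1].
  have /eqP := delta_diff_sigma Tt dF0; rewrite subr_eq => /eqP ->.
  have /eqP := delta_diff_sigma Tt dF1; rewrite subr_eq => /eqP ->.
  by rewrite cisQD // DE mulrDl mul1r addrAC subrr add0r scalerAl.
have {}D0 : D = c0%:A + c1 *: u by apply: D0; rewrite /mu -st subrr.
apply: delta_diff_dense => // e e0.
set Y := cisQ u (F0 t) (F1 t).
have Y0 := normr_ge0 Y. have n0 := normr_ge0 c0. have n1 := normr_ge0 c1.
(* The increments satisfy |a| + |b| <= (2 + |c0| + |c1|) X, and the two linearisation errors add 2 k
   X, hence 4 + |c0| + |c1|. The factor |Y| + 1 replaces |Y| to stay positive. *)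
have [||k [k0 k1 ke]] := @exists_small_factor _ ((4 + `|c0| + `|c1|) * (`|Y| + 1)) e.
- by apply: mulr_gt0; lra.
- by [].
have [d d0 Hd] := cisQ_littleo u1 k0.
have /cvgrPdist_le/(_ _ d0) C0 := delta_diff_cvg Tt dF0.
have /cvgrPdist_le/(_ _ d0) C1 := delta_diff_cvg Tt dF1.
move/delta_diffP : dF0 => /(_ _ k0) dF0; move/delta_diffP : dF1 => /(_ _ k0) dF1.
rewrite -st in dF0 dF1.
near=> s.
have h0 : `|F0 t - F0 s| <= d by near: s.
have h1 : `|F1 t - F1 s| <= d by near: s.
have g0 : `|F0 t - F0 s - (t - s) * c0| <= k * `|t - s| by near: s.
have g1 : `|F1 t - F1 s - (t - s) * c1| <= k * `|t - s| by near: s.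
set X := `|t - s| in g0 g1 *.
have X0 : 0 <= X by exact: normr_ge0.
set a := F0 s - F0 t; set b := F1 s - F1 t.
have na : `|a| <= (`|c0| + 1) * X.
  rewrite /a distrC -(subrK ((t - s) * c0) (F0 t - F0 s)).
  by apply: le_trans (ler_normD _ _) _; rewrite normrM -/X; nra.
have nb : `|b| <= (`|c1| + 1) * X.
  rewrite /b distrC -(subrK ((t - s) * c1) (F1 t - F1 s)).
  by apply: le_trans (ler_normD _ _) _; rewrite normrM -/X; nra.
have ha : `|a| <= d by rewrite /a distrC.
have hb : `|b| <= d by rewrite /b distrC.
have hcis := Hd a b ha hb.
have -> : cisQ u (F0 s) (F1 s) = cisQ u a b * Y.
  by rewrite -cisQD // /a /b !subrK.
have -> : Y - cisQ u a b * Y - (t - s) *: (D * Y) =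
   - ((cisQ u a b - 1 - (a%:A + b *: u)) + ((a + (t - s) * c0)%:A + (b + (t - s) * c1) *: u)) * Y.
  rewrite scalerAl -[X in X - _ - _](mul1r Y) -!mulrBl; congr (_ * _).
  have -> : (a + (t - s) * c0)%:A + (b + (t - s) * c1) *: u =
      (a%:A + b *: u) + (t - s) *: D.
    by rewrite D0 (scalerDl _ a) (scalerDl _ b) scalerDr !quat_scalerA addrACA.
  by rewrite addrA subrK opprD opprB.
rewrite quat_normM normrN.
have n2 : `|(a + (t - s) * c0)%:A + (b + (t - s) * c1) *: u| <= k * X + k * X.
  apply: le_trans (ler_normD _ _) _; rewrite !normrZ u1 quat_norm1 !mulr1.
  apply: lerD; rewrite -normrN opprD -addrC.
    by rewrite /a opprB addrC.
  by rewrite /b opprB addrC.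
apply: (@le_trans _ _ (k * X * (4 + `|c0| + `|c1|) * `|Y|)).
  apply: ler_wpM2r => //; apply: le_trans (ler_normD _ _) _.
  apply: le_trans (lerD hcis n2) _.
  have : k * (`|a| + `|b|) <= k * ((`|c0| + 1) * X + (`|c1| + 1) * X).
    by rewrite ler_pM2l //; exact: lerD.
  by lra.
have := ler_wpM2r X0 ke; apply: le_trans.
set M := 4 + _ + _.
have -> : k * (M * (`|Y| + 1)) * X = k * X * M * (`|Y| + 1) by ring.
by apply: ler_wpM2l; rewrite ?lerDl // !mulr_ge0 ?(ltW k0) // /M; lra.
Unshelve. all: by end_near. Qed.

(** The order of the factors is kept throughout. The error splits into f (sigma t) times the error
    of g, the error of f times g s, and (sigma t - s) f' (g t - g s), the last one being small
    because g is continuous. *)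
Lemma delta_diffM (f g : R -> H) t (f' g' : H) : T t ->
  delta_diff T f t f' -> delta_diff T g t g' ->
  delta_diff T (fun s => f s * g s) t (f' * g t + f (sigma T t) * g').
Proof.
move=> Tt df dg; apply/delta_diffP => e e0.
have cg := delta_diff_cvg Tt dg.
set S := sigma T t in df dg *.
pose K := `|f S| + (`|g t| + 1) + `|f'|.
have K0 : 0 < K + 1.
  by rewrite /K; have := normr_ge0 (f S); have := normr_ge0 (g t);
    have := normr_ge0 f'; lra.
have [k [k0 k1 ke]] := exists_small_factor K0 e0.
move/delta_diffP : df => /(_ _ k0) df; move/delta_diffP : dg => /(_ _ k0) dg.
move/cvgrPdist_le : cg => /(_ _ k0) cg.
near=> s.
have h1 : `|f S - f s - (S - s) *: f'| <= k * `|S - s| by near: s.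
have h2 : `|g S - g s - (S - s) *: g'| <= k * `|S - s| by near: s.
have h3 : `|g t - g s| <= k by near: s.
have -> : f S * g S - f s * g s - (S - s) *: (f' * g t + f S * g') =
    f S * (g S - g s - (S - s) *: g') + (f S - f s - (S - s) *: f') * g s -
    (S - s) *: (f' * (g t - g s)).
  rewrite scalerDr !mulrBr !mulrBl -quat_scalerAr -scalerAl scalerBr.
  rewrite opprD opprB !addrA [RHS](ACl (1*2*4*6*7*5*8*3))%AC /=.
  by rewrite !subrK.
have g0 : `|g s| <= `|g t| + 1.
  rewrite -(subKr (g t) (g s)); apply: le_trans (ler_normB _ _) _.
  by rewrite lerD2l (le_trans h3).
apply: le_trans (ler_normB _ _) _.
apply: le_trans (lerD (ler_normD _ _) (lexx _)) _.
rewrite normrZ !quat_normM.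
set X := `|S - s| in h1 h2 *.
have X0 : 0 <= X by exact: normr_ge0.
have b1 : `|f S| * `|g S - g s - (S - s) *: g'| <= `|f S| * (k * X).
  by apply: ler_wpM2l.
have b2 : `|f S - f s - (S - s) *: f'| * `|g s| <= (k * X) * (`|g t| + 1).
  by apply: ler_pM.
have b3 : X * (`|f'| * `|g t - g s|) <= X * (`|f'| * k).
  by apply: ler_wpM2l => //; apply: ler_wpM2l.
have : k * (K + 1) * X <= e * X by apply: ler_wpM2r.
have : 0 <= k * X by rewrite mulr_ge0 // ltW.
by rewrite /K; lra.
Unshelve. all: by end_near. Qed.

End QuaternionDelta.

(** * The cylinder transformation *)

Section Cylinder.
Variable R : realType.
Local Notation H := (quat R).
Implicit Types (h x y e K : R).

(* Coordinates of cylinder h (x + y u) for y >= 0. At y = 0 the arccos is 0 or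
   pi according to the sign of 1 + h x, which is the real branch of Ln. *)
Definition cyl_radius h x y : R := Num.sqrt ((1 + h * x) ^+ 2 + (h * y) ^+ 2).
Definition cyl_re h x y := if h == 0 then x else h^-1 * ln (cyl_radius h x y).
Definition cyl_im h x y :=
  if h == 0 then y else h^-1 * acos ((1 + h * x) / cyl_radius h x y).

Definition unit_imag (u : H) := q0 u = 0 /\ q1 u ^+ 2 + q2 u ^+ 2 + q3 u ^+ 2 = 1.

Lemma unit_imag_norm u : unit_imag u -> `|u| = 1.
Proof. by move=> [u0 u1]; rewrite quat_normE u0 expr0n add0r u1 sqrtr1. Qed.

Lemma unit_imag_sqr u : unit_imag u -> u * u = -1.
Proof.
case: u => a b c d [/= -> u1]; apply: quat_eq => /=; try ring.
by rewrite -u1; ring.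
Qed.

Lemma unit_imag_qi : unit_imag (qi R).
Proof. by split => //=; rewrite expr1n !expr0n !addr0. Qed.

Lemma quat_coords_norm u h x y : unit_imag u ->
  `|1 + h *: (x%:A + y *: u)| = cyl_radius h x y.
Proof.
case: u => a b c d [/= -> u1]; rewrite quat_normE /cyl_radius /=; congr Num.sqrt.
have -> : (h * y) ^+ 2 = (h * y) ^+ 2 * (b ^+ 2 + c ^+ 2 + d ^+ 2) by rewrite u1 mulr1.
by ring.
Qed.

(** For y > 0 the normalised imaginary part is u and not -u. For y = 0 the real branch of Ln puts
    its term pi along i, which forces u = i. *)
Lemma cylinder_coords u h x y : unit_imag u -> 0 <= y -> (y = 0 -> u = qi R) ->
  0 <= h -> 1 + h *: (x%:A + y *: u) != 0 ->
  cylinder h (x%:A + y *: u) = (cyl_re h x y)%:A + cyl_im h x y *: u.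
Proof.
move=> hu y0 uy h0 nz; rewrite /cylinder /cyl_re /cyl_im; case: ifPn => // hn.
rewrite -!quat_scalerA -scalerDr; congr (_ *: _).
have hp : 0 < h by rewrite lt_neqAle eq_sym hn.
move: nz; rewrite -normr_gt0 => nz.
rewrite /LnQ (quat_coords_norm _ _ _ hu) /is_realQ /reQ.
rewrite (quat_coords_norm _ _ _ hu) in nz.
set q := 1 + _.
have q0E : q0 q = 1 + h * x by rewrite /q /= (proj1 hu) /=; ring.
have imE : imQ q = (h * y) *: u.
  by apply: quat_eq; rewrite /q /= ?(proj1 hu) /=; ring.
rewrite q0E imE.
have [yE|yn] := eqVneq y 0.
  move: nz; rewrite /cyl_radius yE !mulr0 scale0r eqxx expr0n /= addr0 sqrtr_sqr.
  move=> nz; rewrite (uy yE); congr (_ + _ *: _).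
  have [lt0|gt0|E0] := ltgtP (1 + h * x) 0; last by rewrite E0 normr0 ltxx in nz.
    rewrite ltr0_sg // ltr0_norm // invrN mulrN divff ?lt_eqF // acosN1.
    by field.
  by rewrite gtr0_sg // gtr0_norm // divff ?gt_eqF // acos1; field.
have hy : 0 < h * y by rewrite mulr_gt0 // lt_neqAle eq_sym yn.
have u1 := unit_imag_norm hu.
rewrite ifF; last first.
  by apply/negP; rewrite -normr_eq0 normrZ u1 mulr1 normr_eq0 gt_eqF.
congr (_ + _ *: _).
by rewrite normrZ u1 mulr1 gtr0_norm // quat_scalerA mulVf ?gt_eqF // scale1r.
Qed.

(** Polar form: exp (Ln q) = q for q = 1 + h (x + y u). The sine of the arccosine is a nonnegative
    square root, equal to h y / r because y >= 0. *)
Lemma cisQ_cyl u h x y : unit_imag u -> 0 <= y -> 0 < h ->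
  1 + h *: (x%:A + y *: u) != 0 ->
  cisQ u (h * cyl_re h x y) (h * cyl_im h x y) = 1 + h *: (x%:A + y *: u).
Proof.
move=> hu y0 h0; rewrite -normr_gt0 (quat_coords_norm _ _ _ hu) => r0.
rewrite /cyl_re /cyl_im gt_eqF // !mulVKf ?gt_eqF // /cisQ lnK //.
set r := cyl_radius h x y in r0 *.
have r2 : r ^+ 2 = (1 + h * x) ^+ 2 + (h * y) ^+ 2.
  by rewrite sqr_sqrtr // addr_ge0 ?sqr_ge0.
have c1 : -1 <= (1 + h * x) / r <= 1.
  rewrite -ler_norml normrM normfV (gtr0_norm r0) ler_pdivrMr // mul1r.
  rewrite -(ler_pXn2r (ltn0Sn 1)) ?nnegrE ?normr_ge0 ?(ltW r0) //.
  by rewrite real_normK ?num_real // r2 lerDl sqr_ge0.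
rewrite acosK ?in_itv // sin_acos //.
have -> : Num.sqrt (1 - ((1 + h * x) / r) ^+ 2) = h * y / r.
  have -> : 1 - ((1 + h * x) / r) ^+ 2 = (h * y / r) ^+ 2.
    have -> : (h * y / r) ^+ 2 = (r ^+ 2 - (1 + h * x) ^+ 2) / r ^+ 2.
      have -> : r ^+ 2 - (1 + h * x) ^+ 2 = (h * y) ^+ 2 by rewrite r2; ring.
      by field; rewrite gt_eqF.
    by field; rewrite gt_eqF.
  by rewrite sqrtr_sqr ger0_norm // divr_ge0 ?(ltW r0) // mulr_ge0 // ltW.
rewrite scalerDr !quat_scalerA ![r * _]mulrC !divfK ?gt_eqF //.
by rewrite scalerDr !quat_scalerA scalerDl scale1r addrA.
Qed.

(** * Uniform behaviour of the cylinder coordinates as h tends to 0 *)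

Lemma ln_littleo e : 0 < e -> exists2 d : R, 0 < d &
  forall w : R, `|w| <= d -> `|ln (1 + w) - w| <= e * `|w|.
Proof.
move=> e0.
have [d d0 Hd] := is_derive1_littleo (is_derive1_ln (ltr01 : (0 : R) < 1)) e0.
by exists d => // w /Hd; rewrite ln1 subr0 invr1 mul1r.
Qed.

Lemma atan_littleo e : 0 < e -> exists2 d : R, 0 < d &
  forall w : R, `|w| <= d -> `|atan w - w| <= e * `|w|.
Proof.
move=> e0.
have [d d0 Hd] := is_derive1_littleo (is_derive1_atan (0 : R)) e0.
by exists d => // w /Hd; rewrite add0r atan0 subr0 expr0n addr0 invr1 mul1r.
Qed.

(** Both sides are the argument of a + b i in [0, pi/2). As h tends to 0 the arccosine is evaluated
    near 1, where it is not differentiable; the arctangent is evaluated near 0, where it is. *)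
Lemma acos_atan (a b : R) : 0 < a -> 0 <= b ->
  acos (a / Num.sqrt (a ^+ 2 + b ^+ 2)) = atan (b / a).
Proof.
move=> a0 b0; set r := Num.sqrt _.
have s0 : 0 < a ^+ 2 + b ^+ 2 by rewrite ltr_wpDr ?sqr_ge0 // exprn_gt0.
have r0 : 0 < r by rewrite sqrtr_gt0.
have z0 : 0 <= b / a by rewrite divr_ge0 // ltW.
have -> : a / r = cos (atan (b / a)).
  rewrite cos_atan.
  have -> : 1 + (b / a) ^+ 2 = (a ^+ 2 + b ^+ 2) / a ^+ 2.
    by field; rewrite gt_eqF.
  rewrite sqrtrM ?(ltW s0) // sqrtrV ?sqr_ge0 // sqrtr_sqr gtr0_norm //.
  by rewrite -/r; field; rewrite !gt_eqF.
have pi0 := pi_gt0 R.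
have /andP[_ lt] : - (pi / 2) < atan (b / a) < pi / 2 by rewrite atan_gtNpi2 atan_ltpi2.
apply: cosK; rewrite in_itv /=; apply/andP; split; last lra.
by rewrite -(@atan0 R) le_atan.
Qed.

Lemma cyl_re_near K e : 0 < K -> 0 < e -> exists2 d, 0 < d &
  forall h x y, 0 <= h < d -> `|x| <= K -> `|y| <= K -> `|cyl_re h x y - x| <= e.
Proof.
move=> K0 e0.
have [|d d0 Hd] := @ln_littleo (e / (4 * K)); first by rewrite divr_gt0 // mulr_gt0.
(* The three bounds on h keep 1 + h x positive with h^2 (2 K^2) <= h K, make h^2 (2 K^2) <= h e, and
   put w = |1 + h (x + y u)|^2 - 1, of size at most 4 h K, in the range of the expansion of ln. *)
exists (Num.min (1 / (2 * K)) (Num.min (e / (2 * K ^+ 2)) (d / (4 * K)))).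
  by rewrite !lt_min !divr_gt0 ?mulr_gt0 ?exprn_gt0.
move=> h x y /andP[h0]; rewrite !lt_min !ltr_pdivlMr ?mulr_gt0 ?exprn_gt0 //.
move=> /and3P[h1 h2 h3] xK yK.
rewrite /cyl_re; case: ifPn => hn; first by rewrite subrr normr0 ltW.
have {hn}hp : 0 < h by rewrite lt_neqAle eq_sym hn.
have hx : `|h * x| <= h * K by rewrite normrM gtr0_norm // ler_pM2l.
have ax : 0 < 1 + h * x by move: hx; rewrite ler_norml; lra.
set w := 2 * (h * x) + h ^+ 2 * (x ^+ 2 + y ^+ 2).
have rE : cyl_radius h x y ^+ 2 = 1 + w.
  by rewrite sqr_sqrtr ?addr_ge0 ?sqr_ge0 // /w; ring.
have r0 : 0 < cyl_radius h x y.
  by rewrite sqrtr_gt0 ltr_wpDr ?sqr_ge0 // exprn_gt0.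
have s0 : 0 <= x ^+ 2 + y ^+ 2 by rewrite addr_ge0 ?sqr_ge0.
have sK : x ^+ 2 + y ^+ 2 <= 2 * K ^+ 2.
  have sq (v : R) : `|v| <= K -> v ^+ 2 <= K ^+ 2.
    by move=> vK; rewrite -real_normK ?num_real // ler_pXn2r ?nnegrE // ltW.
  by have := sq x xK; have := sq y yK; lra.
have hs : h ^+ 2 * (x ^+ 2 + y ^+ 2) <= h ^+ 2 * (2 * K ^+ 2).
  by apply: ler_wpM2l => //; exact: sqr_ge0.
have hs0 : 0 <= h ^+ 2 * (x ^+ 2 + y ^+ 2) by rewrite mulr_ge0 ?sqr_ge0.
have hK0 : 0 < h * K by exact: mulr_gt0.
have hs1 : h ^+ 2 * (2 * K ^+ 2) <= h * K.
  have -> : h ^+ 2 * (2 * K ^+ 2) = (h * K) * (h * (2 * K)) by ring.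
  by rewrite -[leRHS]mulr1 ler_pM2l // ltW.
have hs2 : h ^+ 2 * (2 * K ^+ 2) <= h * e.
  have -> : h ^+ 2 * (2 * K ^+ 2) = h * (h * (2 * K ^+ 2)) by ring.
  by rewrite ler_pM2l // ltW.
have wK : `|w| <= 4 * (h * K).
  by move: hx; rewrite /w !ler_norml => /andP[? ?]; apply/andP; split; lra.
have lw : `|ln (1 + w) - w| <= h * e.
  apply: le_trans (Hd w _) _; first lra.
  have -> : h * e = e / (4 * K) * (4 * (h * K)) by field; rewrite gt_eqF.
  by apply: ler_wpM2l => //; rewrite divr_ge0 ?mulr_ge0 ?ltW.
have lE : ln (1 + w) = 2 * ln (cyl_radius h x y).
  by rewrite -rE lnXn // mulr_natl.
have -> : h^-1 * ln (cyl_radius h x y) - x =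
   h^-1 * ((ln (1 + w) - w) + h ^+ 2 * (x ^+ 2 + y ^+ 2)) / 2.
  by rewrite lE /w; field; rewrite gt_eqF.
rewrite normrM (gtr0_norm (_ : 0 < 2^-1)) ?invr_gt0 // normrM gtr0_norm ?invr_gt0 //.
rewrite ler_pdivrMr // ler_pdivrMl //.
by apply: le_trans (ler_normD _ _) _; rewrite (ger0_norm hs0); lra.
Qed.

Lemma cyl_im_near K e : 0 < K -> 0 < e -> exists2 d, 0 < d &
  forall h x y, 0 <= h < d -> `|x| <= K -> 0 <= y <= K -> `|cyl_im h x y - y| <= e.
Proof.
move=> K0 e0.
have [|d d0 Hd] := @atan_littleo (e / (4 * K)); first by rewrite divr_gt0 // mulr_gt0.
(* The three bounds on h give 1 + h x >= 1/2, so that z <= 2 h K; make |z - h y| = z |h x| at most h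
   e / 2; and put z in the range of the expansion of atan. *)
exists (Num.min (1 / (2 * K)) (Num.min (e / (4 * K ^+ 2)) (d / (2 * K)))).
  by rewrite !lt_min !divr_gt0 ?mulr_gt0 ?exprn_gt0.
move=> h x y /andP[h0]; rewrite !lt_min !ltr_pdivlMr ?mulr_gt0 ?exprn_gt0 //.
move=> /and3P[h1 h2 h3] xK /andP[y0 yK].
rewrite /cyl_im; case: ifPn => hn; first by rewrite subrr normr0 ltW.
have {hn}hp : 0 < h by rewrite lt_neqAle eq_sym hn.
have hx : `|h * x| <= h * K by rewrite normrM gtr0_norm // ler_pM2l.
have ax : 1 / 2 <= 1 + h * x by move: hx; rewrite ler_norml; lra.
have ax0 : 0 < 1 + h * x by lra.
have hy0 : 0 <= h * y by rewrite mulr_ge0.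
rewrite /cyl_radius acos_atan //.
set z := h * y / (1 + h * x).
have z0 : 0 <= z by rewrite divr_ge0 // ltW.
have hyK : h * y <= h * K by rewrite ler_pM2l.
have hK0 : 0 < h * K by exact: mulr_gt0.
have zK : z <= 2 * (h * K).
  by rewrite ler_pdivrMr //; nra.
have az : `|atan z - z| <= h * e / 2.
  apply: le_trans (Hd z _) _; rewrite ger0_norm //; first lra.
  have -> : h * e / 2 = e / (4 * K) * (2 * (h * K)) by field; rewrite gt_eqF.
  by apply: ler_wpM2l => //; rewrite divr_ge0 ?mulr_ge0 ?ltW.
have zy : `|z - h * y| <= h * e / 2.
  have -> : z - h * y = - (z * (h * x)).
    by rewrite /z; field; rewrite gt_eqF.
  rewrite normrN normrM ger0_norm //.
  have : z * `|h * x| <= 2 * (h * K) * (h * K) by apply: ler_pM.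
  have -> : 2 * (h * K) * (h * K) = h * (h * (4 * K ^+ 2)) / 2 by field.
  move=> /le_trans; apply; rewrite ler_pM2r ?invr_gt0 // ler_pM2l // ltW //.
have -> : h^-1 * atan z - y = h^-1 * ((atan z - z) + (z - h * y)).
  by field; rewrite gt_eqF.
rewrite normrM gtr0_norm ?invr_gt0 // ler_pdivrMl //.
by apply: le_trans (ler_normD _ _) _; lra.
Qed.

End Cylinder.

(** * The initial value problem *)

Section RdContinuity.
Variables (R : realType) (T : set R).
Implicit Types (f g : R -> R) (s t : R).

Definition dense_continuous f := forall t, T t -> right_dense T t ->
  f s @[s --> within T (nbhs t)] --> f t.

(** If t is not right-dense, points of T near t lie at t or to its left. On the left either the
    limit at a left-dense point bounds f, or there is a gap and nothing to bound. *)
Lemma rd_locally_bounded f : rd_continuousR T f -> locally_bounded T f.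
Proof.
move=> [rc lc] t Tt.
have [rd|nrd] := pselect (right_dense T t).
  have /cvgrPdist_le/(_ _ ltr01) H := rc t Tt rd.
  exists (`|f t| + 1); near=> s.
  rewrite -(subKr (f t) (f s)); apply: le_trans (ler_normB _ _) _.
  by rewrite lerD2l; near: s.
have ts : t < sigma T t.
  rewrite lt_neqAle sigma_ge // andbT; apply/eqP => E.
  by apply: nrd; rewrite /right_dense -E.
have [K [d d0 Hd]] : exists K : R, exists2 d : R, 0 < d &
    forall s, T s -> t - d < s < t -> `|f s| <= K.
  have [ld|nld] := pselect (left_dense T t); last first.
    have rt : rho T t < t.
      by rewrite lt_neqAle rho_le // andbT; apply/eqP.
    exists 0, (t - rho T t); first by rewrite subr_gt0.
    move=> s Ts; rewrite subKr => /andP[rs st].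
    by have := rho_ge Ts st; rewrite leNgt rs.
  have /cvg_ex[l /cvgrPdist_le/(_ _ ltr01) H] := lc t Tt ld.
  exists (`|l| + 1).
  have /nbhs_ballP[d /= d0 Hd] := H.
  exists d => // s Ts std.
  have : `|l - f s| <= 1.
    by apply: Hd => //; [rewrite /ball /= ltr_norml; lra|lra].
  move=> h; rewrite -(subKr l (f s)); apply: le_trans (ler_normB _ _) _.
  by rewrite lerD2l.
exists (`|f t| + `|K|); apply/near_withinP.
exists (Num.min d (sigma T t - t)); first by rewrite lt_min d0 subr_gt0.
move=> s Ts /andP[+]; rewrite -ltrBlDl lt_min => + /andP[_ sr].
rewrite ltrBlDr -ltrBlDl lt_min => /andP[sl _].
have st : s <= t by apply: (sigma_lt Ts); lra.
have := normr_ge0 (f t); have := normr_ge0 K.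
move: st; rewrite le_eqVlt => /predU1P[->|st]; first lra.
have : `|f s| <= K by apply: Hd => //; lra.
by have := ler_norm K; lra.
Unshelve. all: by end_near. Qed.

Lemma perturbation_locally_bounded f g : locally_bounded T f ->
  (forall t e, T t -> 0 < e ->
    \forall s \near within T (nbhs t), s = t \/ `|g s - f s| <= e) ->
  locally_bounded T g.
Proof.
move=> lf H t Tt; have [K HK] := lf t Tt; have Ht := H t 1 Tt ltr01.
exists (`|g t| + (`|K| + 1)); near=> s.
have K0 := normr_ge0 K; have g0 := normr_ge0 (g t); have lK := ler_norm K.
have hf : `|f s| <= K by near: s.
have [->|h] : s = t \/ `|g s - f s| <= 1 by near: s.
  by lra.
by rewrite -(subrK (f s) (g s)); apply: le_trans (ler_normD _ _) _; lra.
Unshelve. all: by end_near. Qed.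

(** Closeness exempts s = t, so the agreement of g and f at right-dense t is asked for separately;
    there mu = 0 and the cylinder transform is the identity. *)
Lemma perturbation_dense_continuous f g : dense_continuous f ->
  (forall t, T t -> right_dense T t -> g t = f t) ->
  (forall t e, T t -> 0 < e ->
    \forall s \near within T (nbhs t), s = t \/ `|g s - f s| <= e) ->
  dense_continuous g.
Proof.
move=> cf E H t Tt rd; apply/cvgrPdist_le => e e0.
have e2 : 0 < e / 2 by lra.
have Ht := H t _ Tt e2; have /cvgrPdist_le/(_ _ e2) Hf := cf t Tt rd.
near=> s.
have hf : `|f t - f s| <= e / 2 by near: s.
have [->|h] : s = t \/ `|g s - f s| <= e / 2 by near: s.
  by rewrite subrr normr0 ltW.
rewrite E // -(subrKA (f s)); apply: le_trans (ler_normD _ _) _.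
by rewrite (distrC (f s)); lra.
Unshelve. all: by end_near. Qed.

Section CylinderCoordinates.
Variables x y : R -> R.
Hypothesis lx : locally_bounded T x.
Hypothesis ly : locally_bounded T y.
Hypothesis y0 : forall t, T t -> 0 <= y t.

(** Local bounds on x and y provide the K of the uniform estimate, and nearby points other than t
    have graininess below its threshold d. *)
Lemma cyl_perturbation (Phi : R -> R -> R -> R) (z : R -> R) :
  (forall K e, 0 < K -> 0 < e -> exists2 d, 0 < d & forall h t, T t ->
     0 <= h < d -> `|x t| <= K -> `|y t| <= K -> `|Phi h (x t) (y t) - z t| <= e) ->
  forall t e, T t -> 0 < e -> \forall s \near within T (nbhs t),
    s = t \/ `|Phi (mu T s) (x s) (y s) - z s| <= e.
Proof.
move=> H t e Tt e0.
have [K1 HK1] := lx Tt; have [K2 HK2] := ly Tt.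
pose K := `|K1| + `|K2| + 1.
have K0 : 0 < K by rewrite /K; have := normr_ge0 K1; have := normr_ge0 K2; lra.
have [d d0 Hd] := H K e K0 e0.
have Hm := near_mu_small Tt d0.
have HT : \forall s \near within T (nbhs t), T s by apply: withinT.
near=> s.
have Ts : T s by near: s.
have [->|m] : s = t \/ mu T s < d by near: s.
  by left.
have h1 : `|x s| <= K1 by near: s.
have h2 : `|y s| <= K2 by near: s.
right; apply: Hd => //; rewrite ?mu_ge0 //= /K.
  by have := ler_norm K1; have := normr_ge0 K2; lra.
by have := ler_norm K2; have := normr_ge0 K1; lra.
Unshelve. all: by end_near. Qed.

Lemma cyl_re_perturbation t e : T t -> 0 < e ->
  \forall s \near within T (nbhs t),
    s = t \/ `|cyl_re (mu T s) (x s) (y s) - x s| <= e.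
Proof.
apply: cyl_perturbation => K {}e K0 e0.
have [d d0 Hd] := cyl_re_near K0 e0.
by exists d => // h s _ hd xK yK; apply: Hd.
Qed.

Lemma cyl_im_perturbation t e : T t -> 0 < e ->
  \forall s \near within T (nbhs t),
    s = t \/ `|cyl_im (mu T s) (x s) (y s) - y s| <= e.
Proof.
apply: cyl_perturbation => K {}e K0 e0.
have [d d0 Hd] := cyl_im_near K0 e0.
exists d => // h s Ts hd xK yK; apply: Hd => //.
by rewrite y0 //= (le_trans (ler_norm _)).
Qed.

End CylinderCoordinates.

End RdContinuity.

(** * The unique solution and its identification with the generalized exponential *)

Section GeneralizedExponential.
Variables (R : realType) (T : set R).
Hypothesis hT : time_scale T.
Local Notation H := (quat R).
Implicit Types (s t : R).

Lemma cisQ_comm (u : H) (a b x y : R) :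
  cisQ u a b * (x%:A + y *: u) = (x%:A + y *: u) * cisQ u a b.
Proof.
rewrite /cisQ -scalerAl -quat_scalerAr; congr (_ *: _).
rewrite !mulrDl !mulrDr -!scalerAl -!quat_scalerAr !mul1r !mulr1 !quat_scalerA.
by rewrite (AC (2*2) ((1*3)*(2*4)))%AC /= ![x * _]mulrC ![y * _]mulrC.
Qed.

Lemma delta_diff_subr (V : normedModType R) (f : R -> V) t d a :
  delta_diff T f t d -> delta_diff T (fun s => f s - a) t d.
Proof.
move=> D e /D[dl dl0 H]; exists dl => // s Ts /(H s Ts).
by rewrite [f s - a]addrC opprD opprK addrA subrK.
Qed.

Lemma delta_diffN (V : normedModType R) (f : R -> V) t d :
  delta_diff T f t d -> delta_diff T (fun s => - f s) t (- d).
Proof.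
move=> D e /D[dl dl0 H]; exists dl => // s Ts /(H s Ts).
by rewrite scalerN -!opprD normrN.
Qed.

Lemma delta_diff_coords (u : H) (F0 F1 : R -> R) c0 c1 t : `|u| = 1 ->
  delta_diff T F0 t c0 -> delta_diff T F1 t c1 ->
  delta_diff T (fun s => (F0 s)%:A + F1 s *: u) t (c0%:A + c1 *: u).
Proof.
move=> u1 /delta_diffP D0 /delta_diffP D1; apply/delta_diffP => e e0.
have e2 : 0 < e / 2 by lra.
have H0 := D0 _ e2; have H1 := D1 _ e2; near=> s.
have h0 : `|F0 (sigma T t) - F0 s - (sigma T t - s) * c0| <= e / 2 * `|sigma T t - s|.
  by near: s.
have h1 : `|F1 (sigma T t) - F1 s - (sigma T t - s) * c1| <= e / 2 * `|sigma T t - s|.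
  by near: s.
rewrite (splitr e) mulrDl; apply: le_trans (lerD h0 h1).
set S := sigma T t.
have -> : (F0 S)%:A + F1 S *: u - ((F0 s)%:A + F1 s *: u) -
    (S - s) *: (c0%:A + c1 *: u) =
  (F0 S - F0 s - (S - s) * c0)%:A + (F1 S - F1 s - (S - s) * c1) *: u.
  rewrite scalerDr !quat_scalerA 4!scalerBl !opprD.
  by rewrite (AC ((2*2)*2) ((1*3*5)*(2*4*6)))%AC.
by apply: le_trans (ler_normD _ _) _; rewrite !normrZ u1 quat_norm1 !mulr1.
Unshelve. all: by end_near. Qed.

(** Common form of the real and the constant case: one fixed u serves all times, with y >= 0 to
    match the range of the arccosine and u = i wherever p is real. *)
Lemma psi_gen_exp_coords (p : R -> H) (u : H) (x y : R -> R) s t :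
  regressive T p -> unit_imag u ->
  locally_bounded T x -> locally_bounded T y ->
  dense_continuous T x -> dense_continuous T y ->
  (forall r, T r -> p r = (x r)%:A + y r *: u) ->
  (forall r, T r -> 0 <= y r) -> (forall r, T r -> y r = 0 -> u = qi R) ->
  T s -> T t -> psi T p t s = gen_exp T p t s.
Proof.
move=> rp hu lx ly cx cy pE y0 yu Ts Tt.
have [T0 clT] := hT.
have uu := unit_imag_sqr hu; have u1 := unit_imag_norm hu.
pose c0 r := cyl_re (mu T r) (x r) (y r).
pose c1 r := cyl_im (mu T r) (x r) (y r).
have [G0 dG0] : exists F : R -> R, forall r, T r -> delta_diff T F r (c0 r).
  apply: antiderivative_exists => //.
    exact: perturbation_locally_bounded lx (cyl_re_perturbation lx ly).
  apply: perturbation_dense_continuous cx _ (cyl_re_perturbation lx ly).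
  by move=> r Tr rd; rewrite /c0 /cyl_re /mu rd subrr eqxx.
have [G1 dG1] : exists F : R -> R, forall r, T r -> delta_diff T F r (c1 r).
  apply: antiderivative_exists => //.
    exact: perturbation_locally_bounded ly (cyl_im_perturbation lx ly y0).
  apply: perturbation_dense_continuous cy _ (cyl_im_perturbation lx ly y0).
  by move=> r Tr rd; rewrite /c1 /cyl_im /mu rd subrr eqxx.
have cylE r : Tkappa T r ->
    cylinder (mu T r) (p r) = (c0 r)%:A + c1 r *: u.
  move=> kr; have Tr := Tkappa_sub kr; rewrite pE //.
  apply: cylinder_coords => //; [exact: y0|exact: yu|exact: mu_ge0|].
  by rewrite -pE //; exact: rp.
pose F0 r := G0 r - G0 s; pose F1 r := G1 r - G1 s.
have dF0 r : T r -> delta_diff T F0 r (c0 r) by move=> /dG0; exact: delta_diff_subr.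
have dF1 r : T r -> delta_diff T F1 r (c1 r) by move=> /dG1; exact: delta_diff_subr.
have cisE r : Tkappa T r ->
    cisQ u (mu T r * c0 r) (mu T r * c1 r) = 1 + mu T r *: p r.
  move=> kr; have Tr := Tkappa_sub kr.
  have [m0|mn] := eqVneq (mu T r) 0.
    by rewrite m0 !mul0r cisQ00 scale0r addr0.
  rewrite pE //; apply: cisQ_cyl => //; first exact: y0.
    by rewrite lt_neqAle eq_sym mn mu_ge0.
  by rewrite -pE //; exact: rp.
have p0E r : T r -> mu T r = 0 -> p r = (c0 r)%:A + c1 r *: u.
  by move=> Tr m0; rewrite /c0 /c1 m0 /cyl_re /cyl_im eqxx pE.
pose Y r := cisQ u (F0 r) (F1 r).
pose Z r := cisQ u (- F0 r) (- F1 r).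
have solY : solves_ivp T p s Y.
  split; last by rewrite /Y /F0 /F1 !subrr cisQ00.
  move=> r kr; have Tr := Tkappa_sub kr.
  by apply: delta_diff_cisQ (dF0 r Tr) (dF1 r Tr) _ _ => //; [exact: p0E|exact: cisE].
have uniqY z : solves_ivp T p s z -> {in T, z =1 Y}.
  move=> [dz zs] r; rewrite inE => Tr.
  suff : Z s * z s = Z r * z r.
    rewrite zs /Z {1}/F0 {1}/F1 !subrr oppr0 cisQ00 mulr1 => zr.
    by rewrite -[LHS]mul1r -(cisQN (- F0 r) (- F1 r) uu) !opprK -mulrA -zr mulr1.
  apply: (delta_diff0_cst (f := fun r => Z r * z r)) clT _ Ts Tr => q kq.
  have Tq := Tkappa_sub kq.
  (* V is the inverse of 1 + mu p. From V - 1 = - mu V p, the function Z has delta derivative - V p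
     Z, and Z (sigma q) = V Z q, so the two terms of the product rule cancel because p q commutes
     with Z q. *)
  pose V := cisQ u (- (mu T q * c0 q)) (- (mu T q * c1 q)).
  have dZ : delta_diff T Z q (- (V * p q) * Z q).
    apply: delta_diff_cisQ (delta_diffN (dF0 q Tq)) (delta_diffN (dF1 q Tq)) _ _ => //.
      move=> m0; rewrite /V m0 !mul0r oppr0 cisQ00 mul1r p0E //.
      by rewrite !scaleNr opprD.
    rewrite !mulrN -/V scalerN quat_scalerAr.
    have := cisQN (mu T q * c0 q) (mu T q * c1 q) uu.
    by rewrite -/V cisE // mulrDr mulr1 => <-; rewrite addrK.
  have := delta_diffM Tq dZ (dz q kq).
  suff -> : - (V * p q) * Z q * z q + Z (sigma T q) * (p q * z q) = 0 by [].
  have -> : Z (sigma T q) = V * Z q.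
    rewrite /V /Z -cisQD //; congr cisQ.
      have /eqP := delta_diff_sigma Tq (dF0 q Tq).
      by rewrite subr_eq => /eqP ->; rewrite opprD.
    have /eqP := delta_diff_sigma Tq (dF1 q Tq).
    by rewrite subr_eq => /eqP ->; rewrite opprD.
  rewrite !mulrA -(mulrA V (Z q)) /Z pE // cisQ_comm.
  by rewrite !mulNr !mulrA addNr.
have psiE : psi T p t s = Y t.
  rewrite /psi; set S := [set y | _].
  have SY : S Y by [].
  (* The chosen function carries its own uniqueness clause, which applied to Y gives agreement at
     t. *)
  have [_ /(_ Y solY t)] := xgetPex (fun=> 0) (ex_intro S Y SY).
  by rewrite inE => /(_ Tt).
rewrite psiE /gen_exp /delta_integral.
set A := [set F | _].
pose G r := (G0 r)%:A + G1 r *: u.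
have AG : A G.
  move=> r kr; rewrite cylE //.
  by apply: delta_diff_coords => //; [apply: dG0|apply: dG1]; exact: Tkappa_sub.
have := xgetPex (fun=> 0) (ex_intro A G AG); set F := xget _ _ => AF.
have FG : F s - G s = F t - G t.
  apply: (delta_diff0_cst (f := fun r => F r - G r)) clT _ Ts Tt => r kr.
  by rewrite -(subrr (cylinder (mu T r) (p r))); apply: delta_diffB; [exact: AF|exact: AG].
have -> : F t - F s = (F0 t)%:A + F1 t *: u.
  have -> : F t - F s = G t - G s.
    have -> : F t = F s - G s + G t by rewrite FG subrK.
    by rewrite [LHS](ACl (3*2*1*4))%AC /= addrK.
  by rewrite /G opprD addrACA -!scalerBl.
by rewrite expQE.
Qed.

End GeneralizedExponential.

Theorem theorem3p8 (R : realType) (T : set R) (hT : time_scale T)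
    (p : R -> quat R) (hp : rd_regressive T p)
    (hcase : (forall t, T t -> is_realQ (p t)) \/
             (exists2 alpha : quat R, ~~ is_realQ alpha &
                forall t, T t -> p t = alpha))
    (s t : R) (hs : T s) (ht : T t) :
  psi T p t s = gen_exp T p t s.
Proof.
have [[c0 _ _ _] rp] := hp.
have lcst (k : R) : locally_bounded T (fun=> k).
  by move=> r Tr; exists `|k|; near=> q.
have ccst (k : R) : dense_continuous T (fun=> k).
  by move=> r Tr _; exact: cvg_cst.
case: hcase => [preal|[alpha nreal pE]].
  (* A real p has second coordinate 0 everywhere, which dictates u = i. *)
  apply: (@psi_gen_exp_coords _ _ hT p (qi R) (fun r => q0 (p r)) (fun=> 0)) => //.
  - exact: unit_imag_qi.
  - exact: rd_locally_bounded.
  - by have [] := c0.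
  - move=> r /preal/eqP; case: (p r) => a b c d [-> -> ->].
    by apply: quat_eq => /=; ring.
have im0 : 0 < `|imQ alpha| by rewrite normr_gt0.
(* Normalising Im alpha makes y the positive constant |Im alpha|, so the condition at y = 0 is
   vacuous. *)
apply: (@psi_gen_exp_coords _ _ hT p (`|imQ alpha|^-1 *: imQ alpha)
  (fun=> q0 alpha) (fun=> `|imQ alpha|)) => //.
- split; first by rewrite /= mulr0.
  rewrite /= !exprMn -!mulrDr quat_normE /= expr0n add0r exprVn sqr_sqrtr.
    apply: mulVf; move: im0; rewrite quat_normE /= expr0n add0r sqrtr_gt0.
    by move=> /gt_eqF ->.
  by rewrite !addr_ge0 ?sqr_ge0.
- move=> r /pE ->; rewrite quat_scalerA mulfV ?gt_eqF // scale1r.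
  by apply: quat_eq => /=; ring.
- by move=> r _ /eqP; rewrite gt_eqF.
Unshelve. all: by end_near. Qed.
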